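(* There is a universal constant $c>0$ such that for any $\epsilon\in(0,1)$, when $n$ is sufficiently large (depending on $\epsilon$), the $\epsilon$-mixing time of the Loyd process on $G_n$ satisfies $$\tau_{\rm mix}(\epsilon) > c\,n^4\log n.$$
   Context: For $n\ge 2$ let $V_n=\mathbb{Z}_n^2$ be the vertex set of the $n\times n$ torus $G_n$, in which each vertex $v$ is adjacent to $v\pm(1,0)$ and $v\pm(0,1)$. The vertices are occupied by $n^2-1$ distinct tiles and one hole, one particle per vertex. Tiles and hole carry unique labels in $V_n$, the hole having label $(0,0)$, so a configuration is a permutation $\pi$ of $V_n$, with $\pi(v)$ the label of the particle at $v$. If $n$ is even, call a vertex $(y_1,y_2)$ even if $y_1+y_2$ is even and odd otherwise, and let $\Omega$ be the set of configurations $\pi$ such that the parity of the permutation $\pi$ equals the parity of the position of the hole. Loyd process (Loyd chain): at each step, with probability $\frac12$ do nothing; otherwise interchange the hole with one of its four adjacent tiles (one per direction $\pm(1,0),\pm(0,1)$), chosen uniformly at random. The chain is started in $\Omega$ when $n$ is even. Its state space is $\Omega$ if $n$ is even and the set of all permutations of $V_n$ if $n$ is odd; its stationary distribution $\pi$ is uniform on the state space. For a chain on a finite state space $S$ with transition probabilities $p(x,y)$ and stationary distribution $\pi$, set $\|\mu-\nu\|=\frac12\sum_{x\in S}|\mu(x)-\nu(x)|$ and $\tau_{\rm mix}(\epsilon)=\min\{t:\|p^t(x,\cdot)-\pi\|\le\epsilon\text{ for all }x\in S\}$. *)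

(* Defs.v *)
From HB Require Import structures.
From mathcomp Require Import all_boot all_order all_algebra all_fingroup.
From mathcomp Require Import boolp reals constructive_ereal exp.

Set Implicit Arguments.
Unset Strict Implicit.
Unset Printing Implicit Defensive.

Import Order.TTheory GRing.Theory Num.Theory.
Local Open Scope ring_scope.

Section FiniteChain.
Variables (R : realType) (S : finType).
Implicit Types (p : S -> S -> R) (mu nu : S -> R).

Definition tv_dist mu nu : R := 2^-1 * \sum_(x : S) `|mu x - nu x|.

Fixpoint kernel_pow p (t : nat) (x y : S) : R :=
  if t is t'.+1 then \sum_(z : S) p x z * kernel_pow p t' z y
  else (x == y)%:R.

Definition mixed p mu (eps : R) (t : nat) : bool :=
  [forall x : S, tv_dist (kernel_pow p t x) mu <= eps].

(* The minimum is taken in the extended reals, with min(empty set) = +oo. *)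
Definition mixing_time p mu (eps : R) : \bar R :=
  if pselect (exists t, mixed p mu eps t) is left ex
  then ((ex_minn ex)%:R)%:E else +oo%E.

Definition uniform_dist : S -> R := fun=> (#|S|%:R)^-1.

End FiniteChain.

(* 'Z_n is Z/nZ only for n >= 2; all uses below are under this assumption. *)
Notation torus n := ('Z_n * 'Z_n)%type.

Definition config (n : nat) := {perm torus n}.

Section Loyd.
Variable n : nat.
Implicit Types s : config n.

(* s v is the label of the particle at v, and the hole has label (0, 0). *)
Definition hole s : torus n := (s^-1)%g (0, 0).

Definition odd_vertex (v : torus n) : bool := odd (v.1 + v.2)%N.

Definition state_space : {set config n} :=
  if odd n then [set: config n]
  else [set s : config n | odd_perm s == odd_vertex (hole s)].

Definition loyd_state := {s : config n | s \in state_space}.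

(* A list rather than a set: for n = 2 opposite directions coincide in Z/2Z
   but each of the four is still chosen with probability 1/4. *)
Definition directions : seq (torus n) :=
  [:: (1, 0); (-1, 0); (0, 1); (0, -1)].

(* Multiplication of permutations is left to right: the value at v is
   s (tperm h (h + d) v), where h is the position of the hole. *)
Definition swap_hole s (d : torus n) : config n :=
  (tperm (hole s) (hole s + d)%R * s)%g.

Definition loyd_kernel (R : realType) (x y : loyd_state) : R :=
  2^-1 * (y == x)%:R +
  2^-1 * \sum_(d <- directions) 4^-1 * (val y == swap_hole (val x) d)%:R.

End Loyd.

(* Main.v *)
(** Follow the hole and one tile. The wave exp(2 i pi x_1 / n) in the position
x of the tile evolves under this two-particle chain into
exp(2 i pi x_1 / n) phi_t(u), where u is the position of the hole relative to
the tile and phi_t = A^t 1 for a self-adjoint operator A, a lazy random walk on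
u <> 0 twisted by a phase where hole and tile are exchanged. Since
<1, (1 - A) 1> = O(n^-2) while |1|^2 = n^2, log-convexity of t -> <1, A^t 1>
gives <1, A^t 1> >= n^2 exp(-C t / n^4). Started at the identity, the sum over
the tiles of the cosines of their displacements therefore has mean at least
n^(2 - 1/16) - 1 up to time c n^4 log n, whereas its second moment is O(n^2) at
stationarity.

The variance at time t is at most t r^2, where r bounds the effect of one move,
that is, the l1 norm of the gradient of phi. Cauchy-Schwarz and the energy
bound only give r = O(1), but any power of n is enough. Away from u = 0, phi
solves the heat equation of the lazy walk on the torus; filling in its mean at
0 produces a source which is a dipole of size O(n^-1/2) plus a monopole of size
O(n^-2), and Duhamel's formula over a time of order n^(7/2), together with the
smoothing of the walk in l1, gives r = O(n^-1/4). *)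

Require Import Defs.
From HB Require Import structures.
From mathcomp Require Import all_boot all_order all_algebra all_fingroup.
From mathcomp Require Import boolp reals constructive_ereal exp.
From mathcomp Require Import topology normedtype derive realfun sequences.
From mathcomp Require Import trigo ring lra zify.

Set Implicit Arguments.
Unset Strict Implicit.
Unset Printing Implicit Defensive.

Import Order.TTheory GRing.Theory Num.Theory numFieldNormedType.Exports.
Local Open Scope ring_scope.

(** * Smoothing by the lazy walk on the torus *)

Section TorusWalk.
Variables (R : realType) (n : nat).
Local Notation V := (torus n).
Implicit Types (f g : V -> R) (a b u : V).

Definition norm1 f : R := \sum_(u : V) `|f u|.

Lemma sum_shift f a : \sum_(u : V) f (u + a) = \sum_(u : V) f u.
Proof. by rewrite [RHS](reindex_inj (addIr a)). Qed.

Lemma norm1_ge0 f : 0 <= norm1 f.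
Proof. by apply: sumr_ge0. Qed.

Lemma norm1_shift f a : norm1 (fun u => f (u + a)) = norm1 f.
Proof. exact: (sum_shift (fun u => `|f u|)). Qed.

Lemma norm1D f g : norm1 (fun u => f u + g u) <= norm1 f + norm1 g.
Proof. by rewrite /norm1 -big_split; apply: ler_sum => u _; exact: ler_normD. Qed.

Lemma norm1Z c f : norm1 (fun u => c * f u) = `|c| * norm1 f.
Proof. by rewrite /norm1 mulr_sumr; apply: eq_bigr => u _; rewrite normrM. Qed.

Lemma norm1_sum (I : Type) (r : seq I) (F : I -> V -> R) :
  norm1 (fun u => \sum_(i <- r) F i u) <= \sum_(i <- r) norm1 (F i).
Proof. by rewrite exchange_big; apply: ler_sum => u _; exact: ler_norm_sum. Qed.

Definition grad a f : V -> R := fun u => f (u + a) - f u.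

Lemma norm1_gradN a f : norm1 (grad (- a) f) = norm1 (grad a f).
Proof.
rewrite -(norm1_shift _ a); apply: eq_bigr => u _.
by rewrite /grad addrK distrC.
Qed.

Definition walk a b f : V -> R := fun u =>
  2^-1 * f u + 8^-1 * (f (u + a) + f (u - a) + f (u + b) + f (u - b)).

Variables a b : V.
Local Notation P := (walk a b).

Lemma iter_walk_lin i c f g u :
  iter i P (fun v => c * f v + g v) u = c * iter i P f u + iter i P g u.
Proof. elim: i u => // i IH u; rewrite !iterS /walk !IH; ring. Qed.

Lemma iter_walkZ i c f u : iter i P (fun v => c * f v) u = c * iter i P f u.
Proof. elim: i u => // i IH u; rewrite !iterS /walk !IH; ring. Qed.

Lemma iter_walk_sum (I : Type) (r : seq I) (c : I -> R) (F : I -> V -> R) i g u :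
  iter i P (fun v => \sum_(e <- r) c e * F e v + g v) u =
  \sum_(e <- r) c e * iter i P (F e) u + iter i P g u.
Proof.
elim: r g => [|e r IH] g.
  by rewrite big_nil add0r; under eq_fun do rewrite big_nil add0r.
under eq_fun do rewrite big_cons -addrA.
by rewrite iter_walk_lin IH big_cons addrA.
Qed.

Lemma iter_walk_shift i f c u : iter i P (fun v => f (v + c)) u = iter i P f (u + c).
Proof.
by elim: i u => // i IH u; rewrite !iterS {1 3}/walk !IH -!(addrAC u c).
Qed.

Lemma iter_walk_grad i f c : iter i P (grad c f) = grad c (iter i P f).
Proof.
apply/funext => u; rewrite /grad.
under [X in iter i P X]eq_fun do rewrite addrC -mulN1r.
by rewrite iter_walk_lin iter_walk_shift mulN1r addrC.
Qed.

Lemma sum_walk f : \sum_(u : V) P f u = \sum_(u : V) f u.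
Proof.
rewrite /walk big_split /= -!mulr_sumr !big_split /= !(sum_shift f); by field.
Qed.

(* [P] is an average of the four steps (1 + S_d)/2, where S_d is the shift by
   d; the variable z records the signed number of moves minus stays among the
   steps for which d = a was selected. *)
Definition marked_walk (F : V -> R -> R) : V -> R -> R := fun u z =>
  8^-1 * (F u (z - 1) + F (u + a) (z + 1)) + 3 / 8 * F u z +
  8^-1 * (F (u - a) z + F (u + b) z + F (u - b) z).

(* Discrete integration by parts. *)
Lemma iter_marked_walk i f u z :
  iter i marked_walk (fun v w => w * f v) u z =
  z * iter i P f u + i%:R / 8 * grad a (iter i.-1 P f) u.
Proof.
elim: i u z => [|i IH] u z; first by rewrite /= mul0r mul0r addr0.
rewrite iterS {1}/marked_walk !IH [i.+1.-1]/=.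
case: i IH => [|i] IH; first by rewrite /grad /= /walk; field.
have -> : iter i.+2 P f u = P (iter i.+1 P f) u by [].
have : P (grad a (iter i P f)) u = grad a (iter i.+1 P f) u.
  by rewrite -(iter_walk_grad 1) /=.
rewrite [i.+1.-1]/=; move: (grad a (iter i P f)) => g.
rewrite /walk /grad; move: (iter i.+1 P f) => h.
rewrite -[i.+2]addn1 -[i.+1]addn1 !natrD.
move=> E; have {E} : h (u + a) =
  2^-1 * g u + 8^-1 * (g (u + a) + g (u - a) + g (u + b) + g (u - b)) + h u.
  by rewrite E subrK.
by move=> ->; field.
Qed.

(** The l1 norm is shift invariant, so the norms at the various marks z are averaged as by a lazy
    walk that changes z by 1 or -1 with probability 1/8 each; every step adds 1/4 to the second
    moment of z. *)
Lemma norm1_marked_walk i (F : V -> R -> R) (c d : R) :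
  (forall z, norm1 (F^~ z) <= c * z ^+ 2 + d) ->
  forall z, norm1 ((iter i marked_walk F)^~ z) <= c * (z ^+ 2 + i%:R / 4) + d.
Proof.
move=> FP; elim: i => [|i IH] z; first by rewrite mul0r addr0 FP.
move: (iter i marked_walk F) IH (iterS i marked_walk F) => G IH ->.
have step : norm1 ((marked_walk G)^~ z) <= 8^-1 * (norm1 (G^~ (z - 1)) +
    norm1 (G^~ (z + 1))) + 6 / 8 * norm1 (G^~ z).
  have s3 e y := norm1_shift (G^~ y) e.
  have -> : 6 / 8 * norm1 (G^~ z) = 3 / 8 * norm1 (G^~ z) + 8^-1 *
     (norm1 (fun u => G (u - a) z) + norm1 (fun u => G (u + b) z) +
      norm1 (fun u => G (u - b) z)) by rewrite !s3; field.
  rewrite -(s3 a (z + 1)) /norm1 -!big_split /= !mulr_sumr -!big_split /=.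
  apply: ler_sum => u _; rewrite /marked_walk.
  move: (G u (z - 1)) (G (u + a) (z + 1)) (G u z) (G (u - a) z) (G (u + b) z)
    (G (u - b) z) => x1 x2 x3 x4 x5 x6.
  have := ler_normD (8^-1 * (x1 + x2) + 3 / 8 * x3) (8^-1 * (x4 + x5 + x6)).
  have := ler_normD (8^-1 * (x1 + x2)) (3 / 8 * x3).
  have := ler_normD x1 x2; have := ler_normD (x4 + x5) x6.
  have := ler_normD x4 x5.
  rewrite !normrM (ger0_norm (_ : 0 <= 8^-1)) ?invr_ge0//.
  rewrite (ger0_norm (_ : 0 <= (3 : R)))//; lra.
apply: le_trans step _.
have := IH (z - 1); have := IH (z + 1); have := IH z.
rewrite -[i.+1]addn1 natrD; nra.
Qed.

(** Started from [z * f u], the marked walk has at mark 0 after i + 1 steps the value (i + 1)/8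
    times the gradient. With s = sqrt (i + 1), the inequality |z| <= z^2/(2 s) + s/2 and
    [norm1_marked_walk] bound its norm by 5 s/8 times that of f; dividing by s^2/8 leaves 5/s. *)
Lemma walk_smoothing i f :
  norm1 (grad a (iter i P f)) <= 5 / Num.sqrt i.+1%:R * norm1 f.
Proof.
set s := Num.sqrt _; have s0 : 0 < s by rewrite sqrtr_gt0.
have ss : s ^+ 2 = i.+1%:R by rewrite sqr_sqrtr.
have FP z : norm1 (fun u => z * f u) <=
    (norm1 f / (2 * s)) * z ^+ 2 + norm1 f * s / 2.
  rewrite norm1Z; have := norm1_ge0 f; move: (norm1 f) => N N0.
  suff zP : `|z| <= z ^+ 2 / (2 * s) + s / 2.
    apply: le_trans (ler_wpM2r N0 zP) _; rewrite le_eqVlt; apply/orP; left.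
    by apply/eqP; field; rewrite gt_eqF.
  have -> : z ^+ 2 / (2 * s) + s / 2 = (z ^+ 2 + s ^+ 2) / (2 * s).
    by field; rewrite gt_eqF.
  rewrite ler_pdivlMr ?mulr_gt0//.
  rewrite -(real_normK (num_real z)); have := sqr_ge0 (`|z| - s); nra.
have := norm1_marked_walk i.+1 FP 0.
have -> : norm1 (fun u => iter i.+1 marked_walk (fun v w => w * f v) u 0) =
    s ^+ 2 / 8 * norm1 (grad a (iter i P f)).
  rewrite ss -[X in X * _]ger0_norm ?divr_ge0// -norm1Z.
  by apply: eq_bigr => u _; rewrite iter_marked_walk mul0r add0r.
rewrite -ss expr0n /= add0r => H.
rewrite -(ler_pM2l (_ : 0 < s ^+ 2 / 8)) ?divr_gt0 ?exprn_gt0//.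
apply: le_trans H _; rewrite le_eqVlt; apply/orP; left; apply/eqP.
by field; rewrite gt_eqF.
Qed.

End TorusWalk.

(** * The twisted walk of the hole relative to a tile *)

Section TwistedWalk.
Variables (R : realType) (n : nat).
Local Notation V := (torus n).
Local Notation N := (Zp_trunc n).+2.
Implicit Types (x y z : 'Z_n) (u d : V) (p q : R * R) (phi psi : V -> R * R).

(** Hypothesis and conclusion have the same shape, so the lemma can be nested: a sum over the torus
    feeds a sum over the directions. *)
Lemma sum_cauchy_schwarz (I : Type) (r : seq I) (a b c : I -> R) :
  (forall i, 0 <= a i) -> (forall i, 0 <= c i) ->
  (forall i, b i ^+ 2 <= a i * c i) ->
  (\sum_(i <- r) b i) ^+ 2 <= (\sum_(i <- r) a i) * (\sum_(i <- r) c i).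
Proof.
move=> a0 c0 bP; elim: r => [|i r IH]; first by rewrite !big_nil expr0n mul0r.
rewrite !big_cons; have := bP i; have := a0 i; have := c0 i.
have : 0 <= \sum_(j <- r) a j by apply: sumr_ge0.
have : 0 <= \sum_(j <- r) c j by apply: sumr_ge0.
move: (a i) (b i) (c i) (\sum_(j <- r) a j) (\sum_(j <- r) b j)
  (\sum_(j <- r) c j) IH.
move=> a1 b1 c1 A B C BAC C0 A0 c10 a10 bac.
suff : 2 * (b1 * B) <= a1 * C + A * c1 by nra.
apply: le_trans (ler_norm _) _.
rewrite -ler_sqr ?nnegrE ?addr_ge0 ?mulr_ge0// real_normK ?num_real//.
have : b1 ^+ 2 * B ^+ 2 <= a1 * c1 * (A * C) by apply: ler_pM => //; exact: sqr_ge0.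
have := sqr_ge0 (a1 * C - A * c1); nra.
Qed.

(** [N] is the order of ['Z_n], equal to n from n = 2 on; [cosz x] and [sinz x] are the real and
    imaginary parts of the character exp(2 i pi x / N). *)
Definition theta : R := pi *+ 2 / N%:R.
Definition cosz x : R := cos ((x : nat)%:R * theta).
Definition sinz x : R := sin ((x : nat)%:R * theta).

Lemma theta_mod (m : nat) :
  m%:R * theta = (m %% N)%:R * theta + (pi *+ 2) *+ (m %/ N).
Proof.
rewrite {1}(divn_eq m N) natrD natrM mulrDl addrC; congr (_ + _).
by rewrite /theta -[RHS]mulr_natl -mulrA (mulrC N%:R) divfK// pnatr_eq0.
Qed.

Lemma cosz_nat m : cosz m%:R = cos (m%:R * theta).
Proof. by rewrite theta_mod (periodicn (@cosD2pi R)) /cosz Zp_nat. Qed.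

Lemma sinz_nat m : sinz m%:R = sin (m%:R * theta).
Proof. by rewrite theta_mod (periodicn (@sinD2pi R)) /sinz Zp_nat. Qed.

Lemma coszD x y : cosz (x + y) = cosz x * cosz y - sinz x * sinz y.
Proof. by rewrite -[x]natr_Zp -[y]natr_Zp -natrD !cosz_nat !sinz_nat natrD mulrDl cosD. Qed.

Lemma sinzD x y : sinz (x + y) = sinz x * cosz y + cosz x * sinz y.
Proof. by rewrite -[x]natr_Zp -[y]natr_Zp -natrD !cosz_nat !sinz_nat natrD mulrDl sinD. Qed.

Lemma cosz0 : cosz 0 = 1. Proof. by rewrite /cosz mul0r cos0. Qed.
Lemma sinz0 : sinz 0 = 0. Proof. by rewrite /sinz mul0r sin0. Qed.

Lemma cosz2Dsinz2 x : cosz x ^+ 2 + sinz x ^+ 2 = 1.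
Proof. exact: cos2Dsin2. Qed.

Lemma coszN x : cosz (- x) = cosz x.
Proof.
have := coszD x (- x); have := sinzD x (- x); have := cosz2Dsinz2 x.
rewrite subrr cosz0 sinz0 => cs1 sD cD.
transitivity (cosz x * (cosz x * cosz (- x) - sinz x * sinz (- x)) +
    sinz x * (sinz x * cosz (- x) + cosz x * sinz (- x))); last by rewrite -cD -sD; ring.
by rewrite -[LHS]mulr1 -cs1; ring.
Qed.

Lemma sinzN x : sinz (- x) = - sinz x.
Proof.
have := coszD x (- x); have := sinzD x (- x); have := cosz2Dsinz2 x.
rewrite subrr cosz0 sinz0 => cs1 sD cD.
transitivity (cosz x * (sinz x * cosz (- x) + cosz x * sinz (- x)) -
    sinz x * (cosz x * cosz (- x) - sinz x * sinz (- x))); last by rewrite -cD -sD; ring.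
by rewrite -[LHS]mulr1 -cs1; ring.
Qed.

(** A pair stands for a complex number and [rot x] for multiplication by exp(i x theta), which is
    unitary for [dotp]. *)
Definition rot x p : R * R :=
  (cosz x * p.1 - sinz x * p.2, sinz x * p.1 + cosz x * p.2).
Definition dotp p q := p.1 * q.1 + p.2 * q.2.

Lemma dotp_rot x p q : dotp (rot x p) q = dotp p (rot (- x) q).
Proof. by rewrite /dotp /rot /= coszN sinzN; ring. Qed.

Lemma rotK x p : rot (- x) (rot x p) = p.
Proof.
rewrite /rot /= coszN sinzN; case: p => a b /=; have := cosz2Dsinz2 x => cs.
by congr pair; rewrite -[RHS]mul1r -cs; ring.
Qed.

(* The relative position u of the hole to a tile after the hole moves by d:
   if the hole moves onto the tile, the two are exchanged and the tile itself
   moves by u; [turn] is the first coordinate of that displacement.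
   The point 0 is isolated. *)
Definition hop d u : V := if u == 0 then 0 else if u + d == 0 then - u else u + d.
Definition turn d u : 'Z_n := if (u != 0) && (u + d == 0) then u.1 else 0.

Lemma hopK d : cancel (hop d) (hop (- d)).
Proof.
move=> u; rewrite {2}/hop; case: eqVneq => [->|u0]; first by rewrite /hop eqxx.
case: eqVneq => [ud|ud]; last by rewrite /hop (negPf ud) addrK (negPf u0).
by rewrite /hop oppr_eq0 (negPf u0) -opprD ud oppr0 eqxx opprK.
Qed.

Lemma turn_hop d u : turn (- d) (hop d u) = - turn d u.
Proof.
rewrite /turn /hop; case: (eqVneq u 0) => [->|u0] /=; first by rewrite ?eqxx ?oppr0.
case: (eqVneq (u + d) 0) => [ud|ud] /=.
  by rewrite oppr_eq0 u0 -opprD ud oppr0 eqxx.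
by rewrite ud addrK (negPf u0) oppr0.
Qed.

Lemma hop_inj d : injective (hop d). Proof. exact: can_inj (hopK d). Qed.

(** The pull-back of a wave under a move of the hole by [d]: a unitary operator whose inverse and
    adjoint is [twist (- d)]. *)
Definition twist d phi : V -> R * R := fun u => rot (turn d u) (phi (hop d u)).

Definition dot phi psi : R := \sum_(u : V) dotp (phi u) (psi u).

Lemma dotC phi psi : dot phi psi = dot psi phi.
Proof. by apply: eq_bigr => u _; rewrite /dotp mulrC [X in _ + X]mulrC. Qed.

Lemma dot_twist d phi psi : dot (twist d phi) psi = dot phi (twist (- d) psi).
Proof.
rewrite [RHS](reindex_inj (@hop_inj d)); apply: eq_bigr => u _.
by rewrite dotp_rot /twist turn_hop hopK.
Qed.

Lemma twistK d phi : twist (- d) (twist d phi) = phi.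
Proof.
apply/funext => u; have := turn_hop (- d) u; have := hopK (- d) u.
by rewrite opprK /twist => -> ->; rewrite -{1}[turn _ _]opprK rotK.
Qed.

Lemma sum_directionsN (f : V -> R) :
  \sum_(d <- directions n) f (- d) = \sum_(d <- directions n) f d.
Proof.
rewrite !big_cons !big_nil /=.
have -> : - ((1, 0) : V) = (-1, 0) by rewrite -[LHS]/(_, _) oppr0.
have -> : - ((-1, 0) : V) = (1, 0) by rewrite -[LHS]/(_, _) oppr0 opprK.
have -> : - ((0, 1) : V) = (0, -1) by rewrite -[LHS]/(_, _) oppr0.
have -> : - ((0, -1) : V) = (0, 1) by rewrite -[LHS]/(_, _) oppr0 opprK.
by ring.
Qed.

Definition evolve phi : V -> R * R := fun u =>
  (2^-1 * (phi u).1 + 8^-1 * \sum_(d <- directions n) (twist d phi u).1,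
   2^-1 * (phi u).2 + 8^-1 * \sum_(d <- directions n) (twist d phi u).2).

Lemma dot_evolve phi psi : dot phi (evolve psi) =
  2^-1 * dot phi psi + 8^-1 * \sum_(d <- directions n) dot phi (twist d psi).
Proof.
rewrite exchange_big /= /dot !mulr_sumr -big_split; apply: eq_bigr => u _ /=.
rewrite /dotp big_split -!mulr_sumr /=; set s1 := \sum_(d <- _) _.
by set s2 := \sum_(d <- _) (_ + _); field.
Qed.

(* With s = 1 this is the quadratic form of [evolve], with s = -1 the
   Dirichlet form of 1 - [evolve]. *)
Definition form (s : R) phi psi : R := 16^-1 * \sum_(d <- directions n) \sum_(u : V)
  (((phi u).1 + s * (twist d phi u).1) * ((psi u).1 + s * (twist d psi u).1) +
   ((phi u).2 + s * (twist d phi u).2) * ((psi u).2 + s * (twist d psi u).2)).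

(** The two square terms agree because [twist d] is unitary. The two cross terms agree after
    summation over d, since taking adjoints replaces d by -d and the directions are closed under
    negation. *)
Lemma formE s phi psi : s * s = 1 -> form s phi psi =
  2^-1 * dot phi psi + s * 8^-1 * \sum_(d <- directions n) dot phi (twist d psi).
Proof.
move=> ss; rewrite /form.
under eq_bigr => d _.
  rewrite (_ : \sum_(u : V) _ = dot phi psi + s * dot phi (twist d psi) +
     s * dot (twist d phi) psi + s * s * dot (twist d phi) (twist d psi)); last first.
    rewrite /dot !mulr_sumr -!big_split; apply: eq_bigr => u _.
    by move: (twist d phi u) (twist d psi u) => p q; rewrite /dotp /=; ring.
  rewrite ss (dot_twist d phi (twist d psi)) twistK (dot_twist d phi).
over.
rewrite !big_split /= -!mulr_sumr (sum_directionsN (fun d => dot phi (twist d psi))).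
rewrite (_ : \sum_(d <- directions n) dot phi psi = 4 * dot phi psi); first by field.
by rewrite !big_cons big_nil; ring.
Qed.

Lemma form1E phi psi : form 1 phi psi = dot phi (evolve psi).
Proof. by rewrite formE ?mulr1// dot_evolve mul1r. Qed.

Lemma formN1E phi psi : form (-1) phi psi = dot phi psi - dot phi (evolve psi).
Proof. by rewrite formE ?mulrNN ?mulr1// dot_evolve; field. Qed.

Lemma form_ge0 s phi : 0 <= form s phi phi.
Proof.
by rewrite mulr_ge0 ?invr_ge0//; do 2![apply: sumr_ge0 => ? _]; rewrite addr_ge0// -expr2 sqr_ge0.
Qed.

Lemma pair_cauchy_schwarz (a b c d : R) :
  (a * c + b * d) ^+ 2 <= (a * a + b * b) * (c * c + d * d).
Proof. have := sqr_ge0 (a * d - b * c); nra. Qed.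

Lemma dot_cauchy_schwarz phi psi : dot phi psi ^+ 2 <= dot phi phi * dot psi psi.
Proof.
apply: sum_cauchy_schwarz => u; last exact: pair_cauchy_schwarz.
all: by rewrite addr_ge0// -expr2 sqr_ge0.
Qed.

Lemma form_cauchy_schwarz s phi psi :
  form s phi psi ^+ 2 <= form s phi phi * form s psi psi.
Proof.
rewrite /form exprMn [leRHS]mulrACA -(expr2 16^-1) ler_pM2l ?exprn_gt0 ?invr_gt0//.
have sq0 (r : seq V) (F : V -> R) G : 0 <= \sum_(u <- r) (F u * F u + G u * G u).
  by apply: sumr_ge0 => u _; rewrite addr_ge0// -expr2 sqr_ge0.
apply: sum_cauchy_schwarz => d //.
apply: sum_cauchy_schwarz => u; last exact: pair_cauchy_schwarz.
all: by rewrite addr_ge0// -expr2 sqr_ge0.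
Qed.

Lemma dot_evolveC phi psi : dot (evolve phi) psi = dot phi (evolve psi).
Proof.
rewrite dotC -!form1E /form; congr (_ * _).
by apply: eq_bigr => d _; apply: eq_bigr => u _; ring.
Qed.

Definition unit1 : V -> R * R := fun=> (1, 0).
Definition unit2 : V -> R * R := fun=> (0, 1).
Definition profile j := iter j evolve unit1.
(** The sequence <1, A^j 1>; the isolated point 0 contributes exactly 1 to every term. *)
Definition mass j := dot unit1 (profile j).

Lemma dot_profile i j : dot (profile i) (profile j) = mass (i + j).
Proof.
elim: i j => // i IH j; rewrite -[LHS]/(dot (evolve (profile i)) _).
by rewrite dot_evolveC -[evolve _]/(profile j.+1) IH addnS addSn.
Qed.

(** Cauchy-Schwarz between A^k 1 and A^(k+1) 1: in the inner product if j = 2k, and in the form of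
    A, nonnegative thanks to the laziness, if j = 2k + 1. *)
Lemma mass_log_convex j : mass j.+1 ^+ 2 <= mass j * mass j.+2.
Proof.
rewrite -[j]odd_double_half -addnn; case: (odd j) => /=.
  have := form_cauchy_schwarz 1 (profile j./2) (profile j./2.+1).
  have evoE i : evolve (profile i) = profile i.+1 by [].
  by rewrite !form1E !evoE !dot_profile add1n !addnS !addSn.
have := dot_cauchy_schwarz (profile j./2) (profile j./2.+1).
by rewrite !dot_profile add0n !addnS !addSn.
Qed.

Lemma mass0 : mass 0 = N%:R ^+ 2.
Proof.
rewrite /mass /dot /dotp /profile /=.
under eq_bigr do rewrite mulr1 mulr0 addr0.
by rewrite sumr_const card_prod !card_ord natrM expr2.
Qed.

End TwistedWalk.

(** * Energy bounds and decay of the mass *)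

Section Estimates.
Variables (R : realType).

Lemma sin_le_id (x : R) : 0 <= x -> sin x <= x.
Proof.
rewrite le_eqVlt => /predU1P[<-|x0]; first by rewrite sin0.
have [|c _] := @MVT R sin cos 0 x x0 (fun y _ => is_derive_sin y).
  by apply: continuous_subspaceT; exact: continuous_sin.
rewrite sin0 !subr0 => ->; have := cos_le1 c; nra.
Qed.

Lemma one_sub_cos_le (x : R) : 0 <= x -> 1 - cos x <= x ^+ 2 / 2.
Proof.
move=> x0; have [y -> y0] : exists2 y, x = y *+ 2 & 0 <= y.
  by exists (x / 2); rewrite ?divr_ge0// [RHS]mulr2n -splitr.
rewrite cos_mulr2n cos2sin2.
have := sin_le_id y0; have := @sin_ge0_pi R y.
have := sin_le1 y; have := sin_geN1 y.
have [xpi|xpi] := leP y pi.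
  by rewrite y0 => _ _ /(_ isT); nra.
have := pi_ge2 R; nra.
Qed.

Variable n : nat.
Local Notation V := (torus n).
Local Notation N := (Zp_trunc n).+2.
Local Notation T := (theta R n).

Lemma theta_gt0 : 0 < T.
Proof. by rewrite divr_gt0// [pi *+ 2]mulr2n addr_gt0 ?pi_gt0. Qed.

Lemma theta_le : T <= 8 / N%:R.
Proof.
rewrite ler_pM2r ?invr_gt0//; have /andP[_] := @pihalf_02 R.
by rewrite [pi *+ 2]mulr2n; lra.
Qed.

Lemma cosz1 : cosz R (1 : 'Z_n) = cos T.
Proof. by rewrite (cosz_nat R n 1) mul1r. Qed.

(** Only u = -d can carry a phase, which is then 0 or one step of the character, and 2 (1 - cos T)
    <= T^2. *)
Lemma sum_turn d : d \in directions n ->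
  \sum_(u : V) 2 * (1 - cosz R (turn d u)) <= T ^+ 2.
Proof.
move=> dP; rewrite (bigD1 (- d))//= big1 ?addr0; last first.
  move=> u ud; rewrite /turn addr_eq0 (negPf ud) andbF cosz0.
  by rewrite subrr mulr0.
have tP : cosz R (turn d (- d)) = 1 \/ cosz R (turn d (- d)) = cos T.
  rewrite /turn addNr eqxx andbT; case: ifP => _; last by left; rewrite cosz0.
  move: dP; rewrite !inE => /or4P[] /eqP -> /=; rewrite coszN ?coszN ?cosz1 ?cosz0;
  by [left|right].
have := one_sub_cos_le (ltW theta_gt0).
by case: tP => ->; [have := sqr_ge0 T|]; lra.
Qed.

Let energy_sum (F : V -> V -> R) :
  (forall d, d \in directions n -> \sum_(u : V) F d u <= T ^+ 2) ->
  16^-1 * (\sum_(d <- directions n) \sum_(u : V) F d u) <= 16 / N%:R ^+ 2.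
Proof.
move=> H; have {H} : \sum_(d <- directions n) \sum_(u : V) F d u <= 4 * T ^+ 2.
  rewrite (_ : 4 * _ = \sum_(d <- directions n) T ^+ 2); last first.
    by rewrite !big_cons big_nil; ring.
  by rewrite !big_seq; apply: ler_sum.
move: (\sum_(d <- _) _) => s sT.
have : T ^+ 2 <= 64 / N%:R ^+ 2.
  rewrite (_ : _ / _ = (8 / N%:R) ^+ 2); last by rewrite expr_div_n; congr (_ / _); ring.
  apply: ler_pM => //; [exact: ltW theta_gt0..|exact: theta_le|exact: theta_le].
by move: (N%:R ^- 2) => *; lra.
Qed.

Lemma energy_unit1 : form (-1) (@unit1 R n) (@unit1 R n) <= 16 / N%:R ^+ 2.
Proof.
apply: energy_sum => d /sum_turn; apply: le_trans; rewrite le_eqVlt.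
apply/orP; left; apply/eqP; apply: eq_bigr => u _ /=.
by have := cosz2Dsinz2 R (turn d u); nra.
Qed.

Lemma energy_unit2 : form (-1) (@unit2 R n) (@unit2 R n) <= 16 / N%:R ^+ 2.
Proof.
apply: energy_sum => d /sum_turn; apply: le_trans; rewrite le_eqVlt.
apply/orP; left; apply/eqP; apply: eq_bigr => u _ /=.
by have := cosz2Dsinz2 R (turn d u); nra.
Qed.

Hypothesis n3 : (2 < n)%N.

Lemma torus_side : N = n. Proof. by rewrite Zp_cast// ltnW. Qed.

Lemma torus_side_ge3 : 3 <= N%:R :> R. Proof. by rewrite torus_side (ler_nat R 3). Qed.

Local Notation m := (@mass R n).
Local Notation prof := (@profile R n).

Lemma mass_gap0 : m 0 - m 1 = form (-1) (@unit1 R n) (@unit1 R n).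
Proof. by rewrite formN1E. Qed.

Lemma energy_small : 16 / N%:R ^+ 2 < (N%:R ^+ 2 : R).
Proof.
have := torus_side_ge3; move: (N%:R) => x x3; have x9 : 9 <= x ^+ 2 by nra.
by rewrite ltr_pdivrMr; nra.
Qed.

(** The energy of the constant is less than m 0, so m 1 > 0; log-convexity then carries positivity
    of two consecutive terms forward. *)
Lemma mass_gt0 j : 0 < m j.
Proof.
have H0 : 0 < m 0 by rewrite mass0 exprn_gt0.
suff [] : 0 < m j /\ 0 < m j.+1 by [].
elim: j => [|j [IH1 IH2]]; split=> //.
  have e1 : 16 / N%:R ^+ 2 < m 0 by rewrite mass0 energy_small.
  have := le_lt_trans energy_unit1 e1; rewrite -mass_gap0.
  by rewrite ltrBlDr ltrDl.
rewrite -(pmulr_rgt0 _ IH1); apply: lt_le_trans (mass_log_convex _ _ j).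
by rewrite exprn_gt0.
Qed.

(** A positive log-convex sequence is convex, so its decrements are largest at the start. *)
Lemma mass_gap_le j : m j - m j.+1 <= 16 / N%:R ^+ 2.
Proof.
elim: j => [|j IH]; first by rewrite mass_gap0 energy_unit1.
apply: le_trans _ IH; suff : 2 * m j.+1 <= m j + m j.+2 by lra.
have := mass_log_convex R n j; have := mass_gt0 j; have := mass_gt0 j.+2.
have := mass_gt0 j.+1; move: (m j) (m j.+1) (m j.+2) => x y z y0 z0 x0 yxz.
rewrite -ler_sqr ?nnegrE ?addr_ge0 ?mulr_ge0 ?(ltW x0) ?(ltW y0) ?(ltW z0)//.
by have := sqr_ge0 (x - z); nra.
Qed.

Lemma energy_profile j :
  form (-1) (prof j) (prof j) <= 16 / N%:R ^+ 2.
Proof.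
rewrite formN1E -[evolve _]/(prof j.+1) !dot_profile addnS.
exact: mass_gap_le.
Qed.

Lemma mass_ratio j : m 1 * m j <= m j.+1 * m 0.
Proof.
elim: j => [|j IH]; first by rewrite mulrC.
rewrite -(ler_pM2r (mass_gt0 j)).
have := mass_log_convex R n j; have := mass_gt0 j; have := mass_gt0 0.
have := mass_gt0 j.+1.
move: (m 0) (m 1) (m j) (m j.+1) (m j.+2) IH => a b x y z IH y0 a0 x0 yxz.
have : b * x * y <= y * a * y by rewrite ler_wpM2r// ltW.
have : a * y ^+ 2 <= a * (x * z) by rewrite ler_wpM2l// ltW.
by nra.
Qed.

(** By [mass_ratio] each ratio of consecutive masses is at least m 1 / m 0, and m 0 = N^2 loses at
    most 16/N^2 in the first step. *)
Lemma mass_ge j : N%:R ^+ 2 * (1 - 16 / N%:R ^+ 4) ^+ j <= m j.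
Proof.
have N0 : 0 < (N%:R : R) by [].
elim: j => [|j IH]; first by rewrite mulr1 mass0.
have m1 : 1 - 16 / N%:R ^+ 4 <= m 1 / m 0.
  rewrite ler_pdivlMr ?mass_gt0// mulrBl mul1r mass0.
  have -> : 16 / N%:R ^+ 4 * N%:R ^+ 2 = 16 / N%:R ^+ 2 :> R.
    by move: (N%:R : R) N0 => x x0; field; rewrite gt_eqF.
  by rewrite lerBlDr -lerBlDl; have := mass_gap_le 0; rewrite mass0.
have p0 : 0 <= 1 - 16 / N%:R ^+ 4 :> R.
  rewrite subr_ge0 ler_pdivrMr ?exprn_gt0// mul1r.
  have : 9 <= N%:R ^+ 2 :> R by have := torus_side_ge3; nra.
  by rewrite (_ : N%:R ^+ 4 = (N%:R ^+ 2) ^+ 2) -?exprM//; nra.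
rewrite [_ ^+ j.+1]exprSr mulrA; apply: le_trans (ler_wpM2r p0 IH) _.
apply: le_trans (ler_wpM2l (ltW (mass_gt0 j)) m1) _.
by rewrite mulrA ler_pdivrMr ?mass_gt0// mulrC mass_ratio.
Qed.

(** Cauchy-Schwarz for the Dirichlet form. With phi = [unit1] or [unit2] it bounds the change in one
    step of the sum of a component of the profile, hence the monopole of the source. *)
Lemma dot_gap_sqr_le phi j : form (-1) phi phi <= 16 / N%:R ^+ 2 ->
  `|dot phi (prof j.+1) - dot phi (prof j)| <= 16 / N%:R ^+ 2.
Proof.
move=> phiP; rewrite distrC.
have := form_cauchy_schwarz (-1) phi (prof j).
rewrite {1}formN1E -[evolve _]/(prof j.+1) => H.
have e0 : 0 <= 16 / N%:R ^+ 2 :> R by rewrite divr_ge0 ?exprn_ge0.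
rewrite -ler_sqr ?nnegrE// real_normK ?num_real//; apply: le_trans H _.
by rewrite expr2 ler_pM ?form_ge0// energy_profile.
Qed.

End Estimates.

(** * First and second order smoothing along the coordinate directions *)

Section WalkDirections.
Variables (R : realType) (n : nat).
Local Notation V := (torus n).
Local Notation P := (@walk R n (1, 0) (0, 1)).
Implicit Types (f : V -> R) (u d : V).

Lemma walkE f u :
  P f u = 2^-1 * f u + 8^-1 * \sum_(d <- directions n) f (u + d).
Proof.
rewrite !big_cons big_nil /walk addr0 !addrA.
have -> : - ((1, 0) : V) = (-1, 0) by rewrite -[LHS]/(_, _) oppr0.
by have -> : - ((0, 1) : V) = (0, -1) by rewrite -[LHS]/(_, _) oppr0.
Qed.

Lemma walkC (a b : V) f : walk a b f = walk b a f.
Proof. by apply/funext => u; rewrite /walk; congr (_ + _ * _); ring. Qed.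

Lemma directions_smoothing d i f : d \in directions n ->
  norm1 (grad d (iter i P f)) <= 5 / Num.sqrt i.+1%:R * norm1 f.
Proof.
have eqw g : iter i (walk (0, 1) (1, 0)) g = iter i P g.
  by apply: eq_iter => h; rewrite walkC.
have -> : directions n = [:: (1, 0); - (1, 0); (0, 1); - (0, 1)].
  by rewrite /directions -[- (1, 0)]/(_, _) -[- (0, 1)]/(_, _) !oppr0.
rewrite !inE => /or4P[] /eqP ->; rewrite ?norm1_gradN.
- exact: walk_smoothing.
- exact: walk_smoothing.
- by rewrite -eqw; exact: walk_smoothing.
- by rewrite -eqw; exact: walk_smoothing.
Qed.

(** Each of the two gradients is smoothed by about half of the i steps; the two halves h and k
    satisfy (h + 1)(k + 1) >= ((i + 1)/2)^2. *)
Lemma double_smoothing d e i f : d \in directions n -> e \in directions n ->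
  norm1 (grad d (iter i P (grad e f))) <= 50 / i.+1%:R * norm1 f.
Proof.
move=> dP eP; rewrite iter_walk_grad -[i in iter i](odd_double_half i) -addnn addnA.
rewrite iterD -iter_walk_grad; set k := (_ + _)%N.
apply: le_trans (directions_smoothing k _ dP) _.
have s0 m : 0 <= 5 / Num.sqrt m%:R :> R by rewrite divr_ge0 ?sqrtr_ge0.
apply: le_trans (ler_wpM2l (s0 _) (directions_smoothing _ _ eP)) _.
rewrite mulrA ler_wpM2r ?norm1_ge0// mulf_div -sqrtrM// -natrM.
have -> : 50 / i.+1%:R = 5 * 5 / (i.+1%:R / 2) :> R by rewrite invf_div mulrA; congr (_ / _); ring.
rewrite ler_pM2l ?mulr_gt0// lef_pV2 ?posrE ?sqrtr_gt0 ?divr_gt0 ?ltr0n//.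
rewrite -[leLHS]ger0_norm ?divr_ge0// -sqrtr_sqr ler_wsqrtr//.
rewrite expr_div_n ler_pdivrMr ?exprn_gt0// -!natrX -natrM ler_nat.
have := odd_double_half i; rewrite -addnn /k; nia.
Qed.

End WalkDirections.

(** * Oscillation on the punctured torus in terms of the energy *)

Section Oscillation.
Variables (R : realType) (n : nat).
Local Notation V := (torus n).
Local Notation N := (Zp_trunc n).+2.

Lemma cycle_osc (f : 'Z_n -> R) x : `|f x - f 0| <= \sum_(z : 'Z_n) `|f (z + 1) - f z|.
Proof.
have H (k : nat) : `|f k%:R - f 0| <= \sum_(i < k) `|f (i%:R + 1) - f i%:R|.
  elim: k => [|k IH]; first by rewrite subrr normr0 big_ord0.
  rewrite big_ord_recr /= -natr1; apply: le_trans (lerD IH (lexx _)).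
  rewrite [leRHS]addrC; apply: le_trans (ler_normD _ _).
  by rewrite addrA subrK.
rewrite -{1}[x]natr_Zp; apply: le_trans (H _) _.
have xN : (x <= N)%N by exact: ltnW (ltn_ord x).
rewrite (big_ord_widen N (fun i : nat => `|f (i%:R + 1) - f i%:R|) xN).
rewrite big_mkcond; apply: ler_sum => i _; case: ifP => // _.
by rewrite natr_Zp.
Qed.

Lemma cycle_osc_sqr (f : 'Z_n -> R) (E : R) x y : 0 <= E ->
  \sum_(z : 'Z_n) (f (z + 1) - f z) ^+ 2 <= E ^+ 2 ->
  `|f x - f y| <= 2 * (Num.sqrt N%:R * E).
Proof.
move=> E0 fE; set s := Num.sqrt _.
suff fs w : `|f w - f 0| <= s * E.
  rewrite -[f x](subrK (f 0)) -addrA (le_trans (ler_normD _ _))// -(opprB (f y)).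
  by rewrite normrN mulr_natl mulr2n lerD.
apply: le_trans (cycle_osc f w) _.
rewrite -ler_sqr ?nnegrE ?mulr_ge0 ?sqrtr_ge0 ?sumr_ge0// exprMn sqr_sqrtr//.
apply: le_trans (_ : (\sum_(z : 'Z_n) 1) * (\sum_(z : 'Z_n) (f (z + 1) - f z) ^+ 2) <= _).
  apply: sum_cauchy_schwarz => // z; first exact: sqr_ge0.
  by rewrite real_normK ?num_real// mul1r.
by rewrite sumr_const card_ord ler_wpM2l.
Qed.

(** Rows and columns that avoid 0 are full cycles, on which Cauchy-Schwarz gives an oscillation of
    at most 2 K. Every point other than 0 reaches (1, 1) along one such row and one such column. *)
Lemma torus_osc (f : V -> R) (E : R) u v : 0 <= E ->
  (forall d, d \in directions n ->
    \sum_(w : V | (w != 0) && (w + d != 0)) (f (w + d) - f w) ^+ 2 <= E ^+ 2) ->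
  u != 0 -> v != 0 -> `|f u - f v| <= 8 * (Num.sqrt N%:R * E).
Proof.
move=> E0 fE; set K := _ * E.
pose F d w : R := if (w != 0) && (w + d != 0) then (f (w + d) - f w) ^+ 2 else 0.
have F0 d w : 0 <= F d w by rewrite /F; case: ifP => // _; exact: sqr_ge0.
have FE d : d \in directions n -> \sum_(x : 'Z_n) \sum_(y : 'Z_n) F d (x, y) <= E ^+ 2.
  move=> /fE; apply: le_trans; rewrite pair_bigA [leRHS]big_mkcond.
  by apply: ler_sum => -[x y] _; exact: lexx.
have row x y b : b != 0 -> `|f (x, b) - f (y, b)| <= 2 * K.
  move=> b0; apply: (@cycle_osc_sqr (fun z => f (z, b))) => //.
  apply: le_trans (FE (1, 0) _); last by rewrite !inE eqxx.
  apply: ler_sum => z _; rewrite (bigD1 b)//= {1}/F.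
  have -> : ((z, b) : V) + (1, 0) = (z + 1, b) by rewrite -[LHS]/(_, _) addr0.
  by rewrite !xpair_eqE (negPf b0) !andbF lerDl sumr_ge0.
have col x y b : b != 0 -> `|f (b, x) - f (b, y)| <= 2 * K.
  move=> b0; apply: (@cycle_osc_sqr (fun z => f (b, z))) => //.
  apply: le_trans (FE (0, 1) _); last by rewrite !inE eqxx !orbT.
  rewrite exchange_big; apply: ler_sum => z _; rewrite (bigD1 b)//= {1}/F.
  have -> : ((b, z) : V) + (0, 1) = (b, z + 1) by rewrite -[LHS]/(_, _) addr0.
  by rewrite !xpair_eqE (negPf b0) lerDl sumr_ge0.
have tri x y z (c d : R) : `|x - y| <= c -> `|y - z| <= d -> `|x - z| <= c + d.
  by move=> *; rewrite -[x](subrK y) -addrA (le_trans (ler_normD _ _))// lerD.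
have to11 w : w != 0 -> `|f w - f (1, 1)| <= 4 * K.
  case: w => x y w0; rewrite (_ : 4 * K = 2 * K + 2 * K); last by ring.
  have [y0|y0] := eqVneq y 0; last by apply: tri (row x 1 y y0) (col _ _ _ _).
  have x0 : x != 0 by apply: contraNneq w0 => ->; rewrite y0.
  exact: tri (col y 1 x x0) (row _ _ _ _).
move=> u0 v0; rewrite (_ : 8 * K = 4 * K + 4 * K); last by ring.
by apply: tri (to11 u u0) _; rewrite distrC to11.
Qed.

End Oscillation.

(** * Duhamel's formula for the profile *)

Section Flatten.
Variables (R : realType) (n : nat).
Local Notation V := (torus n).
Local Notation N := (Zp_trunc n).+2.
Local Notation P := (@walk R n (1, 0) (0, 1)).
Implicit Types (u d : V) (j i J : nat).

(* [a j] is a component of the profile at time j and [t j d] that of its twist. *)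
Variables (a : nat -> V -> R) (t : nat -> V -> V -> R) (E K : R).
Hypothesis n3 : (2 < n)%N.
Hypothesis E0 : 0 <= E.
Hypothesis aS : forall j u,
  a j.+1 u = 2^-1 * a j u + 8^-1 * \sum_(d <- directions n) t j d u.
Hypothesis tE : forall j d u, u != 0 -> u + d != 0 -> t j d u = a j (u + d).
Hypothesis t0 : forall j d, t j d 0 = a j 0.
Hypothesis tA : forall j d, d \in directions n ->
  \sum_(u : V) (a j u - t j d u) ^+ 2 <= E ^+ 2.
Hypothesis aK : forall j,
  `|\sum_(u : V) a j.+1 u - \sum_(u : V) a j u| <= K.
Hypothesis a0 : forall u v, a 0 u = a 0 v.

Local Notation W := (8 * (Num.sqrt N%:R * E)).

Definition off_sum j := \sum_(u : V | u != 0) a j u.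
Definition off_mean j := off_sum j / (N%:R ^+ 2 - 1).
(** The value of [a j] at the isolated point 0 is frozen; with the mean of the other values in its
    place, the heat equation holds up to a source at 0 and its neighbours. *)
Definition flat j u := if u == 0 then off_mean j else a j u.

Lemma direction_neq0 d : d \in directions n -> d != 0.
Proof.
by rewrite !inE => /or4P[] /eqP ->; rewrite xpair_eqE ?oppr_eq0 ?oner_eq0 ?andbF.
Qed.

Lemma a0_const j : a j.+1 0 = a j 0.
Proof.
rewrite aS; under eq_bigr do rewrite t0.
by rewrite !big_cons big_nil; field.
Qed.

Let torus_side_ge3' : 3 <= N%:R :> R. Proof. exact: torus_side_ge3. Qed.

Lemma off_card_gt0 : 0 < N%:R ^+ 2 - 1 :> R.
Proof. by move: torus_side_ge3'; move: (N%:R : R) => x x3; nra. Qed.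

Lemma sum_off_const (c : R) : \sum_(u : V | u != 0) c = (N%:R ^+ 2 - 1) * c.
Proof.
have : \sum_(u : V) c = N%:R ^+ 2 * c.
  by rewrite sumr_const card_prod !card_ord -[_ *+ (_ * _)]mulr_natl natrM expr2.
by rewrite (bigD1 (0 : V))//= mulrBl mul1r => <-; rewrite addrAC subrr add0r.
Qed.

Lemma twist_close j d u : d \in directions n -> `|t j d u - a j u| <= E.
Proof.
move=> dP; rewrite distrC -ler_sqr ?nnegrE// real_normK ?num_real//.
apply: le_trans (tA j dP); rewrite (bigD1 u)//= lerDl.
by apply: sumr_ge0 => v _; exact: sqr_ge0.
Qed.

Lemma a_osc j u v : u != 0 -> v != 0 -> `|a j u - a j v| <= W.
Proof.
apply: torus_osc => // d dP; apply: le_trans (tA j dP); rewrite big_mkcond.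
apply: ler_sum => w _; case: ifP => [/andP[w0 wd0]|_]; last exact: sqr_ge0.
by rewrite -tE// -opprB sqrrN.
Qed.

Lemma a_mean j u : u != 0 -> `|a j u - off_mean j| <= W.
Proof.
move=> u0; have M0 := off_card_gt0.
rewrite -(ler_pM2l M0) -{1}(gtr0_norm M0) -normrM mulrBr /off_mean.
rewrite (mulrC _ (_ / _)) divfK ?gt_eqF// /off_sum -!sum_off_const -sumrB.
by apply: le_trans (ler_norm_sum _ _ _) _; apply: ler_sum => v v0; exact: a_osc.
Qed.

Definition delta u : R := (u == 0)%:R.
(** At u = -d a step in direction d makes the plain walk read the filled value at 0, where the
    twisted walk reads [t j d (- d)]; this is the weighted difference. *)
Definition dip j d := 8^-1 * (t j d (- d) - off_mean j).
Definition leak j := N%:R ^+ 2 * (off_mean j.+1 - off_mean j).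
Definition source j u :=
  \sum_(d <- directions n) dip j d * grad d delta u + leak j * delta u.

Lemma sum_flat j : \sum_(u : V) flat j u = N%:R ^+ 2 * off_mean j.
Proof.
rewrite (bigD1 (0 : V))//= {1}/flat eqxx (eq_bigr (a j)) => [|u /negPf u0]; last first.
  by rewrite /flat u0.
rewrite -[X in _ + X]/(off_sum j).
rewrite (_ : off_sum j = off_mean j * (N%:R ^+ 2 - 1)).
  by rewrite mulrBr mulr1 addrC subrK mulrC.
by rewrite divfK// gt_eqF// off_card_gt0.
Qed.

(** Away from 0 the identity is checked site by site. At 0 it follows from equality of the totals:
    the walk preserves sums, the dipoles sum to 0, and [leak] is by definition the change of the
    total of [flat]. *)
Lemma flat_step j u : flat j.+1 u = P (flat j) u + source j u.
Proof.
have off v : v != 0 -> flat j.+1 v = P (flat j) v + source j v.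
  move=> v0; rewrite walkE /source /grad /delta {1 2}/flat (negPf v0) mulr0 addr0 aS.
  rewrite -addrA; congr (_ + _); rewrite mulr_sumr mulr_sumr -big_split.
  apply: eq_big_seq => d dP /=; rewrite subr0 /dip /flat.
  case: eqVneq => [vd|vd]; last by rewrite mulr0 addr0 tE.
  by move/eqP: vd; rewrite addr_eq0 => /eqP ->; rewrite mulr1 -mulrDr addrC subrK.
have [->|/off//] := eqVneq u 0.
have tot : \sum_(v : V) flat j.+1 v = \sum_(v : V) (P (flat j) v + source j v).
  rewrite big_split /= sum_walk !sum_flat /source big_split /=.
  rewrite exchange_big /= big1 => [|d _]; last first.
    by rewrite -mulr_sumr /grad sumrB sum_shift subrr mulr0.
  rewrite -mulr_sumr (_ : \sum_(v : V) delta v = 1) ?mulr1 ?add0r.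
    by rewrite /leak -mulrDr addrC subrK.
  rewrite (bigD1 (0 : V))//= big1 => [|v /negPf v0]; first by rewrite /delta eqxx addr0.
  by rewrite /delta v0.
move: tot; rewrite (bigD1 (0 : V))//= [RHS](bigD1 (0 : V))//=.
by rewrite (eq_bigr _ off) => /addIr.
Qed.

Lemma norm1_delta : norm1 delta = 1.
Proof.
rewrite /norm1 (bigD1 (0 : V))//= big1 => [|v /negPf v0]; last by rewrite /delta v0 normr0.
by rewrite /delta eqxx normr1 addr0.
Qed.

(** Four dipoles of size (E + W)/8 under two gradients, at 50/(i + 1) each, and a monopole of size 9
    K/8 under one gradient, at 5/sqrt (i + 1). *)
Definition source_bound i :=
  25 * (E + W) / i.+1%:R + 45 / 8 * K / Num.sqrt i.+1%:R.

Lemma dip_le j d : d \in directions n -> `|dip j d| <= (E + W) / 8.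
Proof.
move=> dP; rewrite normrM ger0_norm ?invr_ge0// mulrC ler_pM2r ?invr_gt0//.
rewrite -[t j d _](subrK (a j (- d))) -addrA (le_trans (ler_normD _ _))//.
by rewrite lerD ?twist_close// a_mean// oppr_eq0 direction_neq0.
Qed.

(** Since [a j 0] does not depend on j, the sum off 0 changes by as much as the full sum; N^2/(N^2 -
    1) <= 9/8 because N >= 3. *)
Lemma leak_le j : `|leak j| <= 9 / 8 * K.
Proof.
have M0 := off_card_gt0.
have -> : leak j = N%:R ^+ 2 / (N%:R ^+ 2 - 1) *
    (\sum_(u : V) a j.+1 u - \sum_(u : V) a j u).
  have aE k : \sum_(u : V) a k u = a k 0 + off_sum k by rewrite (bigD1 (0 : V)).
  rewrite !aE a0_const /leak /off_mean.
  by rewrite -mulrBl opprD addrACA subrr add0r mulrA mulrAC.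
rewrite normrM; apply: ler_pM => //.
rewrite ger0_norm ?divr_ge0 ?exprn_ge0 ?(ltW M0)//.
by rewrite ler_pdivrMr//; move: torus_side_ge3'; move: (N%:R : R) => x x3; nra.
Qed.

Lemma source_le d i j : d \in directions n ->
  norm1 (grad d (iter i P (source j))) <= source_bound i.
Proof.
move=> dP; rewrite -iter_walk_grad.
have -> : grad d (source j) = fun u => \sum_(e <- directions n)
    (dip j e * grad d (grad e delta) u) + leak j * grad d delta u.
  apply/funext => u; rewrite /grad /source opprD addrACA -mulrBr -sumrB.
  by congr (_ + _); apply: eq_bigr => e _; rewrite -mulrBr.
have -> : iter i P (fun u => \sum_(e <- directions n)
    (dip j e * grad d (grad e delta) u) + leak j * grad d delta u) =
  fun u => \sum_(e <- directions n) (dip j e * iter i P (grad d (grad e delta)) u)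
    + leak j * iter i P (grad d delta) u.
  by apply/funext => u; rewrite iter_walk_sum iter_walkZ.
apply: le_trans (norm1D _ _) _; rewrite /source_bound lerD//.
  apply: le_trans (norm1_sum _ _) _.
  have -> : 25 * (E + W) / i.+1%:R =
      \sum_(e <- directions n) (E + W) / 8 * (50 / i.+1%:R).
    by rewrite !big_cons big_nil; move: (_^-1) => z; field.
  rewrite !big_seq; apply: ler_sum => e eP; rewrite norm1Z.
  apply: ler_pM; rewrite ?norm1_ge0 ?dip_le//.
  by have := double_smoothing i delta dP eP; rewrite norm1_delta mulr1 -iter_walk_grad.
rewrite norm1Z; have := directions_smoothing i delta dP.
rewrite norm1_delta mulr1 -iter_walk_grad => H.
apply: le_trans (ler_pM _ _ (leak_le j) H) _; rewrite ?norm1_ge0//.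
by move: (Num.sqrt _)^-1 => z; rewrite le_eqVlt; apply/orP; left; apply/eqP; field.
Qed.

Lemma iter_walk_const i (c : R) : iter i P (fun=> c) = fun=> c.
Proof. by elim: i => // i IH; rewrite iterS IH; apply/funext => u; rewrite /walk; field. Qed.

(** Each unrolling of [flat_step] moves one step from the time index to the iterated walk; the
    general i is what the induction on J needs. *)
Lemma duhamel d J i j : d \in directions n ->
  norm1 (grad d (iter i P (flat (j + J)))) <=
  norm1 (grad d (iter (i + J) P (flat j))) + \sum_(l < J) source_bound (i + l).
Proof.
move=> dP; elim: J i => [|J IH] i; first by rewrite !addn0 big_ord0 addr0.
have -> : iter i P (flat (j + J.+1)) = fun u => iter i.+1 P (flat (j + J)) u +
    iter i P (source (j + J)) u.
  apply/funext => u; rewrite addnS iterSr -[in RHS](mul1r (iter i P _ u)).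
  rewrite -iter_walk_lin; congr (iter i P _ u).
  by apply/funext => v; rewrite mul1r flat_step.
have -> : grad d (fun u => iter i.+1 P (flat (j + J)) u + iter i P (source (j + J)) u)
    = fun u => grad d (iter i.+1 P (flat (j + J))) u + grad d (iter i P (source (j + J))) u.
  by apply/funext => u; rewrite /grad opprD addrACA.
apply: le_trans (norm1D _ _) _.
apply: le_trans (lerD (IH _) (source_le _ _ dP)) _.
rewrite big_ord_recl addn0 addSnnS -addrA lerD2l addrC lerD2l.
by apply: ler_sum => l _; rewrite addSnnS.
Qed.

Lemma norm1_flat_mean j : norm1 (fun u => flat j u - off_mean j) <= N%:R ^+ 2 * W.
Proof.
have W0 : 0 <= W by rewrite !mulr_ge0 ?sqrtr_ge0.
apply: le_trans (_ : \sum_(u : V) W <= _).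
  apply: ler_sum => u _; rewrite /flat; case: ifP => [_|/negbT]; last exact: a_mean.
  by rewrite subrr normr0.
by rewrite sumr_const card_prod !card_ord -[_ *+ (_ * _)]mulr_natl natrM expr2.
Qed.

Lemma grad_flat_le d j J : d \in directions n -> norm1 (grad d (flat j)) <=
  5 / Num.sqrt J.+1%:R * (N%:R ^+ 2 * W) + \sum_(l < J) source_bound l.
Proof.
move=> dP; have K0 : 0 <= K by apply: le_trans (aK 0).
have W0 : 0 <= W by rewrite !mulr_ge0 ?sqrtr_ge0.
have sb0 l : 0 <= source_bound l.
  apply: addr_ge0; first by rewrite divr_ge0// mulr_ge0// addr_ge0.
  by rewrite divr_ge0 ?sqrtr_ge0// mulr_ge0// divr_ge0.
have A0 : 0 <= 5 / Num.sqrt J.+1%:R * (N%:R ^+ 2 * W).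
  by rewrite mulr_ge0 ?divr_ge0 ?sqrtr_ge0// mulr_ge0// exprn_ge0.
(* From time J on, J steps are unrolled and the remaining profile is within W of its mean. Before
   time J everything is unrolled, down to the constant profile at time 0, whose gradient
   vanishes. *)
have [jJ|jJ] := leqP J j.
  have := duhamel J 0 (j - J) dP; rewrite subnK// add0n /= => H.
  apply: le_trans H _; rewrite lerD2r; set h := flat _.
  have -> : grad d (iter J P h) = grad d (iter J P (fun u => h u - off_mean (j - J))).
    apply/funext => u; rewrite -!iter_walk_grad; congr (iter J P _ u).
    by apply/funext => v; rewrite /grad; ring.
  apply: le_trans (directions_smoothing J _ dP) _.
  by rewrite ler_wpM2l ?divr_ge0 ?sqrtr_ge0// norm1_flat_mean.
have := duhamel j 0 0 dP; rewrite !add0n /= => H.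
apply: le_trans H _; apply: lerD.
  rewrite (_ : norm1 _ = 0)//; have -> : flat 0 = fun=> a 0 0.
    apply/funext => u; rewrite /flat; case: ifP => // _.
    rewrite /off_mean /off_sum (eq_bigr _ (fun v _ => a0 v 0)) sum_off_const.
    by rewrite mulrC mulKf// gt_eqF// off_card_gt0.
  by rewrite iter_walk_const /norm1 big1// => u _; rewrite /grad subrr normr0.
rewrite (big_ord_widen J source_bound (ltnW jJ)) big_mkcond.
by apply: ler_sum => l _; case: ifP.
Qed.

(** The twist differs from the shift of [flat] only at u = 0, where it is trivial, and around u =
    -d, which costs at most E. *)
Lemma twist_grad_le d j J : d \in directions n ->
  \sum_(u : V) `|a j u - t j d u| <=
  5 / Num.sqrt J.+1%:R * (N%:R ^+ 2 * W) + \sum_(l < J) source_bound l + E.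
Proof.
move=> dP; apply: le_trans _ (lerD (grad_flat_le j J dP) (lexx E)).
have -> : E = \sum_(u : V) (u == - d)%:R * E.
  rewrite (bigD1 (- d))//= eqxx mul1r big1 ?addr0// => u /negPf ->.
  by rewrite mul0r.
rewrite -big_split; apply: ler_sum => u _ /=.
have [->|u0] := eqVneq u 0; first by rewrite t0 subrr normr0 addr_ge0 ?mulr_ge0.
have [->|ud] := eqVneq u (- d).
  by rewrite mul1r distrC (le_trans (twist_close _ _ dP))// lerDr.
rewrite mul0r addr0 /grad /flat (negPf u0) tE//; last by rewrite addr_eq0.
by rewrite addr_eq0 (negPf ud) distrC.
Qed.

End Flatten.

(** * The l1 gradient of the profile *)

Section ProfileGradient.
Variable R : realType.

Lemma sum_inv_le J : \sum_(l < J) (l.+1%:R)^-1 <= 1 + ln J%:R :> R.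
Proof.
elim: J => [|[|J] IH]; first by rewrite big_ord0 ln0// addr0.
  by rewrite big_ord_recr big_ord0 /= add0r ln1 addr0 invr1.
rewrite big_ord_recr /=; apply: le_trans (lerD IH (lexx _)) _; rewrite -addrA lerD2l.
have J0 : 0 < J.+2%:R :> R by [].
have -> : ln J.+1%:R = ln J.+2%:R + ln (1 - J.+2%:R^-1) :> R.
  have -> : 1 - J.+2%:R^-1 = J.+1%:R / J.+2%:R :> R.
    by rewrite -[X in X - _](divff (lt0r_neq0 J0)) -{2}[_^-1]mul1r -mulrBl -{1}natr1 addrK.
  by rewrite ln_div ?posrE// addrC subrK.
rewrite -addrA gerDl -lerBrDr sub0r; apply: le_ln1Dx.
by rewrite ltrN2 invf_lt1// ltr1n.
Qed.

Lemma sum_inv_sqrt_le J : \sum_(l < J) (Num.sqrt l.+1%:R)^-1 <= 2 * Num.sqrt J%:R :> R.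
Proof.
elim: J => [|J IH]; first by rewrite big_ord0 sqrtr0 mulr0.
rewrite big_ord_recr /=; apply: le_trans (lerD IH (lexx _)) _.
have : Num.sqrt J.+1%:R ^+ 2 = Num.sqrt J%:R ^+ 2 + 1 :> R.
  by rewrite !sqr_sqrtr// -natr1.
have : 0 < Num.sqrt J.+1%:R :> R by rewrite sqrtr_gt0.
move: (Num.sqrt J%:R) (Num.sqrt J.+1%:R) => p q q0 pq.
rewrite -lerBrDl -mulrBr -div1r ler_pdivrMr//; have := sqr_ge0 (p - q); nra.
Qed.

Variable n : nat.
Local Notation V := (torus n).
Local Notation N := (Zp_trunc n).+2.
Hypothesis n3 : (2 < n)%N.
Local Notation prof := (@profile R n).

Lemma component_gradient (a : nat -> V -> R) (t : nat -> V -> V -> R) (x : R) :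
  1 <= x -> x ^+ 4 = N%:R ->
  (forall j u, a j.+1 u = 2^-1 * a j u + 8^-1 * \sum_(d <- directions n) t j d u) ->
  (forall j d u, u != 0 -> u + d != 0 -> t j d u = a j (u + d)) ->
  (forall j d, t j d 0 = a j 0) ->
  (forall j d, d \in directions n ->
    \sum_(u : V) (a j u - t j d u) ^+ 2 <= (16 / N%:R) ^+ 2) ->
  (forall j, `|\sum_(u : V) a j.+1 u - \sum_(u : V) a j u| <= 16 / N%:R ^+ 2) ->
  (forall u v, a 0 u = a 0 v) ->
  forall j d, d \in directions n -> \sum_(u : V) `|a j u - t j d u| <= 256 * 256 / x.
Proof.
move=> x1 xN aS tE t0 tA aK a0 j d dP; have x0 : 0 < x by apply: lt_le_trans x1.
(* With N = x^4, the initial term N^2 W / sqrt J and the monopole term K sqrt J are of orders x^6 /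
   sqrt J and x^-8 sqrt J; sqrt J of order x^7 makes both of order 1/x. *)
pose J := Num.truncn (x ^+ 14).
have /andP[J1 J2] : J%:R <= x ^+ 14 < J.+1%:R.
  by rewrite truncn_itv// exprn_ge0// ltW.
have E0 : 0 <= 16 / N%:R :> R by rewrite divr_ge0.
apply: le_trans (twist_grad_le n3 E0 aS tE t0 tA aK a0 j J dP) _.
have sN : Num.sqrt N%:R = x ^+ 2 :> R.
  have -> : N%:R = (x ^+ 2) ^+ 2 by rewrite -xN -exprM.
  by rewrite sqrtr_sqr ger0_norm// exprn_ge0// ltW.
have s1 : x ^+ 7 <= Num.sqrt J.+1%:R.
  rewrite -[x ^+ 7]ger0_norm ?exprn_ge0 ?(ltW x0)// -sqrtr_sqr ler_wsqrtr// -exprM.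
  exact: ltW.
have s2 : Num.sqrt J%:R <= x ^+ 7.
  rewrite -[x ^+ 7]ger0_norm ?exprn_ge0 ?(ltW x0)// -sqrtr_sqr ler_wsqrtr// -exprM//.
have H1 : \sum_(l < J) (l.+1%:R)^-1 <= 15 * x.
  apply: le_trans (sum_inv_le J) _.
  have : ln J%:R <= 14 * x :> R.
    have [->|J0] := posnP J; first by rewrite ln0// mulr_ge0// ltW.
    apply: le_trans (_ : ln (x ^+ 14) <= _); first by rewrite ler_ln ?posrE ?ltr0n ?exprn_gt0.
    by rewrite lnXn// -[leLHS]mulr_natl ler_wpM2l// ltW// ln_sublinear.
  by move=> *; lra.
have H2 := le_trans (sum_inv_sqrt_le J) (ler_wpM2l (ler0n R 2) s2).
rewrite sN -xN; set y := x^-1.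
have y0 : 0 < y by rewrite invr_gt0.
have y1 : y <= 1 by rewrite invf_le1.
have -> : \sum_(l < J) source_bound n (16 / x ^+ 4) (16 / (x ^+ 4) ^+ 2) l =
   25 * (16 * y ^+ 4 + 128 * y ^+ 2) * \sum_(l < J) (l.+1%:R)^-1 +
   90 * y ^+ 8 * \sum_(l < J) (Num.sqrt l.+1%:R)^-1.
  rewrite !mulr_sumr -big_split; apply: eq_bigr => l _ /=; rewrite /source_bound sN.
  by move: (l.+1%:R^-1) (Num.sqrt _)^-1 => z w; rewrite /y; field; rewrite gt_eqF.
have -> : 5 / Num.sqrt J.+1%:R * ((x ^+ 4) ^+ 2 * (8 * (x ^+ 2 * (16 / x ^+ 4)))) =
   640 * x ^+ 6 / Num.sqrt J.+1%:R.
  by move: (Num.sqrt _)^-1 => w; field; rewrite gt_eqF.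
have A1 : 640 * x ^+ 6 / Num.sqrt J.+1%:R <= 640 * y.
  apply: le_trans (_ : 640 * x ^+ 6 / x ^+ 7 <= _).
    rewrite ler_pM2l ?mulr_gt0 ?exprn_gt0// lef_pV2// ?posrE ?exprn_gt0//.
    by rewrite sqrtr_gt0.
  by rewrite le_eqVlt /y; apply/orP; left; apply/eqP; field; rewrite gt_eqF.
have p1 : y ^+ 4 <= y ^+ 2 by rewrite ler_wiXn2l// ltW.
have p2 : y ^+ 4 <= y by rewrite -[leRHS]expr1 ler_wiXn2l// ltW.
(* The dipoles have size of order x^-2 and the harmonic sum costs at most 15 x, by ln x <= x; 240 *
   225 is 25 * 144 * 15. *)
have A2 : 25 * (16 * y ^+ 4 + 128 * y ^+ 2) * \sum_(l < J) (l.+1%:R)^-1 <= 240 * 225 * y.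
  apply: le_trans (_ : (25 * 144 * y ^+ 2) * (15 * x) <= _).
    apply: ler_pM => //; [|by apply: sumr_ge0 => l _; rewrite invr_ge0|by lra].
    by rewrite mulr_ge0// addr_ge0// mulr_ge0// exprn_ge0// ltW.
  by rewrite le_eqVlt /y; apply/orP; left; apply/eqP; field; rewrite gt_eqF.
have A3 : 90 * y ^+ 8 * \sum_(l < J) (Num.sqrt l.+1%:R)^-1 <= 180 * y.
  apply: le_trans (_ : 90 * y ^+ 8 * (2 * x ^+ 7) <= _).
    by rewrite ler_wpM2l// mulr_ge0// exprn_ge0// ltW.
  by rewrite le_eqVlt /y; apply/orP; left; apply/eqP; field; rewrite gt_eqF.
have -> : 16 / x ^+ 4 = 16 * y ^+ 4 by rewrite /y exprVn.
by rewrite -/y; lra.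
Qed.

(** A single direction is at most the whole Dirichlet sum, which is 16 times an energy bounded by
    16/N^2. *)
Lemma twist_closeness j d : d \in directions n ->
  \sum_(u : V) (((prof j u).1 - (twist d (prof j) u).1) ^+ 2 +
                ((prof j u).2 - (twist d (prof j) u).2) ^+ 2) <= (16 / N%:R) ^+ 2.
Proof.
move=> dP; have := energy_profile R n3 j; rewrite /form mulrC ler_pdivrMr//.
have -> : 16 / N%:R ^+ 2 * 16 = (16 / N%:R) ^+ 2 :> R.
  by rewrite expr_div_n expr2 mulrAC.
apply: le_trans; rewrite [leRHS](big_rem d)//=.
set A := \sum_(u : V) _; set B := \sum_(u : V) _; have -> : A = B.
  by apply: eq_bigr => u _; rewrite !mulN1r -!expr2.
rewrite lerDl; apply: sumr_ge0 => e _; apply: sumr_ge0 => u _.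
by rewrite addr_ge0// -expr2 sqr_ge0.
Qed.

Lemma profile_gradient (x : R) : 1 <= x -> x ^+ 4 = N%:R ->
  forall j d, d \in directions n ->
  \sum_(u : V) (`|(prof j u).1 - (twist d (prof j) u).1| +
                `|(prof j u).2 - (twist d (prof j) u).2|) <= 512 * 256 / x.
Proof.
move=> x1 xN j d dP; rewrite big_split /=.
have -> : 512 * 256 / x = 256 * 256 / x + 256 * 256 / x by rewrite -mulrDl; congr (_ / _); ring.
have hopE e u : u != 0 -> u + e != 0 -> hop e u = u + e.
  by move=> u0 ue; rewrite /hop (negPf u0) (negPf ue).
have turnE e u : (u + e != 0) || (u == 0) -> turn e u = 0.
  by rewrite /turn; case: (u == 0); case: (u + e == 0).
have rot0 p : rot 0 p = p :> R * R.
  by case: p => p q; rewrite /rot cosz0 sinz0 /= !mul1r !mul0r subr0 add0r.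
have twE k e u : u != 0 -> u + e != 0 -> twist e (prof k) u = prof k (u + e).
  by move=> u0 ue; rewrite /twist turnE ?ue// rot0 hopE.
have tw0 k e : twist e (prof k) 0 = prof k 0.
  by rewrite /twist turnE ?eqxx ?orbT// rot0 /hop eqxx.
apply: lerD.
  apply: (@component_gradient (fun k u => (prof k u).1)
            (fun k e u => (twist e (prof k) u).1) x) => //.
  - by move=> k e u u0 ue; rewrite twE.
  - by move=> k e; rewrite tw0.
  - move=> k e eP; apply: le_trans (twist_closeness k eP).
    by apply: ler_sum => u _; rewrite lerDl sqr_ge0.
  - move=> k; have := dot_gap_sqr_le n3 k (energy_unit1 R n).
    have dE i : dot (@unit1 R n) (prof i) = \sum_(u : V) (prof i u).1.
      by apply: eq_bigr => u _; rewrite /dotp mul1r mul0r addr0.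
    by rewrite !dE.
apply: (@component_gradient (fun k u => (prof k u).2)
          (fun k e u => (twist e (prof k) u).2) x) => //.
- by move=> k e u u0 ue; rewrite twE.
- by move=> k e; rewrite tw0.
- move=> k e eP; apply: le_trans (twist_closeness k eP).
  by apply: ler_sum => u _; rewrite lerDr sqr_ge0.
- move=> k; have := dot_gap_sqr_le n3 k (energy_unit2 R n).
  have dE i : dot (@unit2 R n) (prof i) = \sum_(u : V) (prof i u).2.
    by apply: eq_bigr => u _; rewrite /dotp mul1r mul0r add0r.
  by rewrite !dE.
Qed.

End ProfileGradient.

(** * Second moments of finite chains *)

Lemma sum_quadratic (R : realType) (S : finType) (w g : S -> R) (a b c : R) :
  \sum_y w y = 1 -> \sum_y w y * (a * g y ^+ 2 + b * g y + c) =
  a * \sum_y w y * g y ^+ 2 + b * \sum_y w y * g y + c.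
Proof.
move=> w1; rewrite -[c in RHS]mul1r -w1 mulr_suml !mulr_sumr -!big_split.
by apply: eq_bigr => y _ /=; ring.
Qed.

Section FiniteChains.
Variables (R : realType) (S : finType) (p : S -> S -> R).
Hypothesis p0 : forall x y, 0 <= p x y.
Hypothesis p1 : forall x, \sum_y p x y = 1.
Implicit Types (x y : S) (g : S -> R).

Definition avg g x := \sum_y p x y * g y.
Definition avg_at t g x := \sum_y kernel_pow p t x y * g y.

Lemma avg_at0 g x : avg_at 0 g x = g x.
Proof.
rewrite /avg_at (bigD1 x)//= eqxx mul1r big1 ?addr0// => y /negPf yx.
by rewrite eq_sym yx mul0r.
Qed.

Lemma avg_atS t g x : avg_at t.+1 g x = avg (avg_at t g) x.
Proof.
rewrite /avg_at /avg /=; under eq_bigr do rewrite mulr_suml.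
rewrite exchange_big; apply: eq_bigr => z _ /=; rewrite mulr_sumr.
by apply: eq_bigr => y _; rewrite mulrA.
Qed.

Lemma kernel_pow_ge0 t x y : 0 <= kernel_pow p t x y.
Proof.
elim: t x => [|t IH] x /=; first by case: (x == y).
by apply: sumr_ge0 => z _; rewrite mulr_ge0.
Qed.

Lemma avg1 x : avg (fun=> 1) x = 1.
Proof. by rewrite /avg; under eq_bigr do rewrite mulr1; rewrite p1. Qed.

Lemma avg_at1 t x : avg_at t (fun=> 1) x = 1.
Proof.
elim: t x => [|t IH] x; first by rewrite avg_at0.
by rewrite avg_atS -[RHS](avg1 x); congr avg; apply/funext => y; rewrite IH.
Qed.

Lemma sum_kernel_pow t x : \sum_y kernel_pow p t x y = 1.
Proof. by rewrite -[RHS](avg_at1 t x); apply: eq_bigr => y _; rewrite mulr1. Qed.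

Lemma avg_le g h x : (forall y, g y <= h y) -> avg g x <= avg h x.
Proof. by move=> gh; apply: ler_sum => y _; rewrite ler_wpM2l. Qed.

Section Martingale.
Variables (F : nat -> S -> R) (r : R).
Hypothesis FS : forall j x, avg (F j) x = F j.+1 x.
Hypothesis Fr : forall j x, avg (fun y => (F j y - F j x) ^+ 2) x <= r.

Lemma avg_at_mean t x : avg_at t (F 0) x = F t x.
Proof.
elim: t x => [|t IH] x; first by rewrite avg_at0.
by rewrite avg_atS -FS; congr avg; apply/funext.
Qed.

(** The variance about the mean [F j.+1 x] is at most the second moment about any other point, here
    [F j x]. *)
Lemma avg_sqr j x : avg (fun y => F j y ^+ 2) x <= F j.+1 x ^+ 2 + r.
Proof.
have := Fr j x; have -> : (fun y => (F j y - F j x) ^+ 2) =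
  (fun y => 1 * F j y ^+ 2 + - (2 * F j x) * F j y + F j x ^+ 2).
  by apply/funext => y; ring.
rewrite {1}/avg.
rewrite sum_quadratic// -!/(avg _ x) FS.
have := sqr_ge0 (F j x - F j.+1 x); nra.
Qed.

Lemma avg_at_sqr t x : avg_at t (fun y => F 0 y ^+ 2) x <= F t x ^+ 2 + t%:R * r.
Proof.
elim: t x => [|t IH] x; first by rewrite avg_at0 mul0r addr0.
rewrite avg_atS; apply: le_trans (avg_le _ IH) _.
have -> : (fun y => F t y ^+ 2 + t%:R * r) =
  (fun y => 1 * F t y ^+ 2 + 0 * F t y + t%:R * r).
  by apply/funext => y; ring.
rewrite {1}/avg.
rewrite sum_quadratic// -!/(avg _ x).
by have := avg_sqr t x; rewrite -natr1; lra.
Qed.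

(** Along the chain X, the process F (t - s) (X s) is a martingale in s, so the variance of its
    final value is a sum of t one-step variances. *)
Lemma avg_at_variance t x :
  avg_at t (fun y => (F 0 y - F t x) ^+ 2) x <= t%:R * r.
Proof.
have -> : (fun y => (F 0 y - F t x) ^+ 2) =
  (fun y => 1 * F 0 y ^+ 2 + - (2 * F t x) * F 0 y + F t x ^+ 2).
  by apply/funext => y; ring.
rewrite {1}/avg_at.
rewrite sum_quadratic ?sum_kernel_pow// -!/(avg_at t _ x) avg_at_mean.
by have := avg_at_sqr t x; nra.
Qed.

End Martingale.

(** Chebyshev's inequality for the test function F: values far from 0 are charged to nu, values far
    from m to mu. *)
Lemma tv_dist_ge (mu nu F : S -> R) (m : R) : 0 < m ->
  (forall x, 0 <= mu x) -> (forall x, 0 <= nu x) ->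
  \sum_x mu x = 1 -> \sum_x nu x = 1 ->
  1 - 4 / m ^+ 2 * (\sum_x mu x * (F x - m) ^+ 2 + \sum_x nu x * F x ^+ 2)
    <= tv_dist mu nu.
Proof.
move=> m0 mu0 nu0 mu1 nu1.
have c0 : 0 < 4 / m ^+ 2 by rewrite divr_gt0// exprn_gt0.
have cm : 4 / m ^+ 2 * m ^+ 2 = 4 by rewrite divfK// gt_eqF// exprn_gt0.
rewrite /tv_dist -(ler_pM2l (ltr0Sn R 1)) [leRHS]mulrA mulfV ?pnatr_eq0// mul1r mulrBr mulr1.
have -> : 2 - 2 * (4 / m ^+ 2 * (\sum_x mu x * (F x - m) ^+ 2 + \sum_x nu x * F x ^+ 2)) =
  \sum_x (mu x + nu x - 2 * (4 / m ^+ 2 * (mu x * (F x - m) ^+ 2 + nu x * F x ^+ 2))).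
  rewrite sumrB big_split /= mu1 nu1 -mulr_sumr -mulr_sumr big_split /=.
  by congr (_ - _); ring.
apply: ler_sum => x _; move: (4 / m ^+ 2) c0 cm => c c0 cm.
have [M0 N0] := (mu0 x, nu0 x); move: (mu x) (nu x) (F x) M0 N0 => a b f a0 b0.
have f2 := sqr_ge0 f; have g2 := sqr_ge0 (f - m).
have A : 0 <= c * (a * (f - m) ^+ 2) := mulr_ge0 (ltW c0) (mulr_ge0 a0 g2).
have B : 0 <= c * (b * f ^+ 2) := mulr_ge0 (ltW c0) (mulr_ge0 b0 f2).
have [f1|f1] := leP 1 (c * f ^+ 2).
  have : b <= c * (b * f ^+ 2) by rewrite mulrCA ler_peMr.
  have := ler_norm (a - b); rewrite mulrDr; lra.
have g1 : 1 <= c * (f - m) ^+ 2.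
  (* By the parallelogram identity f and f - m cannot both be smaller than m/2 in absolute value. *)
  have : 2 * (c * f ^+ 2) + 2 * (c * (f - m) ^+ 2) =
     c * m ^+ 2 + c * (2 * f - m) ^+ 2 by ring.
  have : 0 <= c * (2 * f - m) ^+ 2 by rewrite mulr_ge0 ?sqr_ge0// ltW.
  by rewrite cm; lra.
have : a <= c * (a * (f - m) ^+ 2) by rewrite mulrCA ler_peMr.
by have := ler_norm (b - a); rewrite distrC mulrDr; lra.
Qed.

End FiniteChains.

(** * The Loyd chain *)

Section LoydChain.
Variables (R : realType) (n : nat).
Local Notation V := (torus n).
Local Notation N := (Zp_trunc n).+2.
Implicit Types (s : config n) (d k : V) (phi : V -> R * R) (g : config n -> R).

Definition pos s k : V := (s^-1)%g k.

(** The real part of the sum over the tiles of exp(i theta x) phi(u), with x the first coordinate of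
    the tile's displacement and u the hole's position relative to it. For [unit1] it is the sum of
    the cosines. *)
Definition observable phi s : R := \sum_(k : V | k != 0)
  (cosz R (pos s k - k).1 * (phi (hole s - pos s k)).1 -
   sinz R (pos s k - k).1 * (phi (hole s - pos s k)).2).

Lemma pos_swap s d k : pos (swap_hole s d) k = tperm (hole s) (hole s + d) (pos s k).
Proof. by rewrite /pos /swap_hole invMg permM tpermV. Qed.

Lemma hole_swap s d : hole (swap_hole s d) = hole s + d.
Proof. by rewrite -[LHS]/(pos _ 0) pos_swap -[pos s 0]/(hole s) tpermL. Qed.

Lemma observable_swap phi s d :
  observable phi (swap_hole s d) = observable (twist d phi) s.
Proof.
apply: eq_bigr => k k0; rewrite hole_swap pos_swap.
have xh : pos s k != hole s by rewrite (inj_eq perm_inj).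
move: (hole s) (pos s k) xh => h x xh; have u0 : h - x != 0 by rewrite subr_eq0 eq_sym.
pose x' := tperm h (h + d) x.
suff [-> ->] : h + d - x' = hop d (h - x) /\ (x' - k).1 = turn d (h - x) + (x - k).1.
  rewrite /twist coszD sinzD; move: (phi _) => [p q]; rewrite /rot /=.
  have ringE (a b c e : R) : (a * c - b * e) * p - (b * c + a * e) * q =
    c * (a * p - b * q) - e * (b * p + a * q) by ring.
  exact: ringE.
rewrite /x' /hop /turn (negPf u0) /=; have [ud|ud] := eqVneq (h - x + d) 0.
  have -> : x = h + d by apply/eqP; rewrite eq_sym -subr_eq0 -addrAC ud.
  rewrite tpermR; split; first by rewrite opprB.
  by rewrite -[RHS]/((h - (h + d) + (h + d - k)).1) addrA subrK.
rewrite tpermD; [by rewrite add0r addrAC|by rewrite eq_sym|].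
by rewrite -subr_eq0 addrAC.
Qed.

Lemma direction_parity (v d : V) : (1 < n)%N -> ~~ odd n -> d \in directions n ->
  odd_vertex (v + d) = ~~ odd_vertex v.
Proof.
move=> n1 oddn; have oN : odd N = false by rewrite Zp_cast// (negPf oddn).
have o1 : odd ((1%R : 'Z_n) : nat) by [].
have oD (x y : 'Z_n) : odd ((x + y)%R : nat) = odd x (+) odd y.
  by rewrite [(x + y)%R : nat]/= odd_mod// oddD.
have oM1 : odd ((-1 : 'Z_n)%R : nat) by have := oD 1%R (-1)%R; rewrite subrr o1 /=; case: odd.
case: v => x y; have vE a b : odd_vertex (((x, y) : V) + (a, b)) =
    (odd x (+) odd a) (+) (odd y (+) odd b) by rewrite -!oD /odd_vertex oddD.
rewrite !inE => /or4P[] /eqP ->; rewrite vE ?o1 ?oM1 /odd_vertex oddD /=;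
by case: (odd x); case: (odd y).
Qed.

Hypothesis n3 : (2 < n)%N.

(** A move is a transposition and sends the hole to a neighbour, so for even n both parities
    flip. *)
Lemma swap_state s d : s \in state_space n -> d \in directions n ->
  swap_hole s d \in state_space n.
Proof.
rewrite /state_space; case: ifP => [|/negbT oddn]; first by rewrite !inE.
move=> + dP; rewrite !inE hole_swap odd_mul_tperm direction_parity//; last exact: ltnW.
have -> : hole s != hole s + d.
  by rewrite -subr_eq0 opprD addrA subrr sub0r oppr_eq0 direction_neq0.
by move=> /eqP ->; case: odd_vertex.
Qed.

Local Notation K := (@loyd_kernel n R).

Lemma loyd_avg g (x : loyd_state n) : avg K (fun y => g (val y)) x =
  2^-1 * g (val x) + 8^-1 * \sum_(d <- directions n) g (swap_hole (val x) d).
Proof.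
have at1 (z : loyd_state n) : \sum_(y : loyd_state n) (y == z)%:R * g (val y) = g (val z).
  by rewrite (bigD1 z)//= eqxx mul1r big1 ?addr0// => y /negPf ->; rewrite mul0r.
rewrite /avg /loyd_kernel; under eq_bigr do rewrite mulrDl -mulrA.
rewrite big_split -mulr_sumr at1 /=; congr (_ + _).
under eq_bigr do rewrite -mulrA mulr_suml mulr_sumr.
rewrite exchange_big mulr_sumr; apply: eq_big_seq => d dP /=.
have sP := swap_state (valP x) dP.
rewrite -{2}[swap_hole _ _]/(val (Sub (swap_hole (val x) d) sP : loyd_state n)) -at1 mulr_sumr.
by apply: eq_bigr => y _; rewrite -val_eqE /=; field.
Qed.

Lemma loyd_kernel_ge0 x y : 0 <= K x y.
Proof.
rewrite addr_ge0 ?mulr_ge0 ?invr_ge0//.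
by apply: sumr_ge0 => d _; rewrite mulr_ge0 ?invr_ge0.
Qed.

Lemma loyd_kernel_sum x : \sum_y K x y = 1.
Proof.
have := loyd_avg (fun=> 1) x; rewrite /avg.
under eq_bigr do rewrite mulr1.
by move=> ->; rewrite !big_cons big_nil; field.
Qed.

Lemma observable_evolve phi s : observable (evolve phi) s =
  2^-1 * observable phi s + 8^-1 * \sum_(d <- directions n) observable (twist d phi) s.
Proof.
rewrite /observable exchange_big 2!mulr_sumr -big_split; apply: eq_bigr => k _.
rewrite sumrB -!mulr_sumr /evolve.
by set a := \sum_(d <- _) _.1; set b := \sum_(d <- _) _.2 => /=; field.
Qed.

Local Notation prof := (@profile R n).

Lemma loyd_observable j (x : loyd_state n) :
  avg K (fun y => observable (prof j) (val y)) x = observable (prof j.+1) (val x).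
Proof.
rewrite (loyd_avg (observable (prof j))) -[prof j.+1]/(evolve (prof j)).
rewrite observable_evolve; congr (_ + _ * _).
by apply: eq_bigr => d _; rewrite observable_swap.
Qed.

(** Distinct tiles see the hole at distinct relative positions, so the sum over tiles is at most the
    sum over all u. *)
Lemma observable_jump phi s d : `|observable (twist d phi) s - observable phi s| <=
  \sum_(u : V) (`|(phi u).1 - (twist d phi u).1| + `|(phi u).2 - (twist d phi u).2|).
Proof.
pose F (u : V) : R :=
  `|(phi u).1 - (twist d phi u).1| + `|(phi u).2 - (twist d phi u).2|.
have F0 u : 0 <= F u by rewrite addr_ge0.
rewrite -sumrB; apply: le_trans (ler_norm_sum _ _ _) _.
apply: le_trans (_ : \sum_(k : V | k != 0) F (hole s - pos s k) <= _).
  apply: ler_sum => k _; rewrite /F.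
  move: (twist d phi _) (phi _) (_.1) => [a b] [a' b'] z /=.
  have -> : cosz R z * a - sinz R z * b - (cosz R z * a' - sinz R z * b') =
    cosz R z * (a - a') - sinz R z * (b - b') by ring.
  apply: le_trans (ler_normB _ _) _; rewrite !normrM (distrC a') (distrC b').
  have := cos_max ((z : nat)%:R * theta R n); have := sin_max ((z : nat)%:R * theta R n).
  by rewrite -/(cosz R z) -/(sinz R z) => *; rewrite lerD// ler_piMl.
apply: le_trans (_ : \sum_(k : V) F (hole s - pos s k) <= _).
  by rewrite [leRHS](bigID (fun k : V => k != 0))/= lerDl sumr_ge0.
rewrite le_eqVlt; apply/orP; left; apply/eqP.
rewrite [RHS](reindex_inj (_ : injective (fun k => hole s - pos s k)))//.
by move=> k l /addrI /oppr_inj /perm_inj.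
Qed.

Lemma observable_variation (r : R) j (x : loyd_state n) : 0 <= r ->
  (forall d, d \in directions n ->
    \sum_(u : V) (`|(prof j u).1 - (twist d (prof j) u).1| +
                  `|(prof j u).2 - (twist d (prof j) u).2|) <= r) ->
  avg K (fun y => (observable (prof j) (val y) - observable (prof j) (val x)) ^+ 2) x
    <= r ^+ 2.
Proof.
move=> r0 rP; set o := observable (prof j) (val x).
rewrite (loyd_avg (fun s => (observable (prof j) s - o) ^+ 2)) subrr expr0n mulr0 add0r.
have : \sum_(d <- directions n) (observable (prof j) (swap_hole (val x) d) - o) ^+ 2 <=
    \sum_(d <- directions n) r ^+ 2.
  rewrite !big_seq; apply: ler_sum => d dP; rewrite observable_swap.
  rewrite -real_normK ?num_real// ler_sqr ?nnegrE//.
  exact: le_trans (observable_jump _ _ _) (rP d dP).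
rewrite [X in _ <= X](_ : _ = 4 * r ^+ 2); last by rewrite !big_cons big_nil; ring.
by have := sqr_ge0 r; lra.
Qed.

End LoydChain.

(** * The stationary second moment *)

Section StationaryMoment.
Variables (R : realType) (n : nat).
Local Notation V := (torus n).
Local Notation N := (Zp_trunc n).+2.
Hypothesis n3 : (2 < n)%N.
Local Notation Omega := (state_space n).
Implicit Types (s c : config n) (k l m : V) (f : V -> R).

(** Multiplying by c on the right relabels the tiles; the hole stays in place and the parity is
    unchanged, so the state space is preserved. *)
Lemma sum_relabel c (G : config n -> R) : c 0 = 0 -> odd_perm c = false ->
  \sum_(s in Omega) G (s * c)%g = \sum_(s in Omega) G s.
Proof.
move=> c0 cE; rewrite [RHS](reindex_inj (mulIg c)); apply: eq_bigl => s /=.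
rewrite /state_space; case: ifP => _; rewrite !inE// odd_permM cE addbF.
have c0' : (c^-1)%g (0, 0) = (0, 0) := canLR (permK c) (esym c0).
by rewrite /hole invMg permM c0'.
Qed.

Definition corr f k l : R := \sum_(s in Omega) f (pos s k) * f (pos s l).

Lemma corrC f k l : corr f k l = corr f l k.
Proof. by apply: eq_bigr => s _; rewrite mulrC. Qed.

(** A 3-cycle of labels is even, so relabelling by it is allowed for even n as well. *)
Lemma corr_cycle f k l m : k != 0 -> l != 0 -> m != 0 -> k != l -> l != m -> k != m ->
  corr f k m = corr f k l.
Proof.
move=> k0 l0 m0 kl lm km; pose c : config n := (tperm k l * tperm l m)%g.
have c0 : c 0 = 0 by rewrite permM !tpermD.
have cE : odd_perm c = false by rewrite odd_permM !odd_tperm kl lm.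
rewrite [RHS]corrC /corr -(sum_relabel (fun s => f (pos s k) * f (pos s m)) c0 cE).
apply: eq_bigr => s _; rewrite /pos !invMg !permM !tpermV.
have -> : tperm l m k = k by rewrite tpermD// eq_sym.
by rewrite tpermL !tpermR.
Qed.

Lemma corr_const f k l k' l' : k != 0 -> l != 0 -> k' != 0 -> l' != 0 ->
  k != l -> k' != l' -> corr f k l = corr f k' l'.
Proof.
have step a b b' : a != 0 -> b != 0 -> b' != 0 -> a != b -> a != b' ->
    corr f a b = corr f a b'.
  move=> a0 b0 b'0 ab ab'; have [->//|bb'] := eqVneq b b'.
  by rewrite (@corr_cycle f a b' b)// eq_sym.
move=> k0 l0 k'0 l'0 kl kl'; have [kk'|kk'] := eqVneq k k'.
  by rewrite -kk' in kl' *; exact: step.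
rewrite (step k l k')// corrC; apply: step => //.
by rewrite eq_sym.
Qed.

Lemma corr_le f k l : (forall v, `|f v| <= 1) -> `|corr f k l| <= #|Omega|%:R.
Proof.
move=> f1; apply: le_trans (ler_norm_sum _ _ _) _; rewrite -sum1_card natr_sum.
by apply: ler_sum => s _; rewrite normrM mulr_ile1.
Qed.

Lemma sum_overlap_sqr f : (forall v, `|f v| <= 1) -> \sum_(v : V) f v = 0 ->
  \sum_(s in Omega) (\sum_(k : V | k != 0) f (pos s k) * f k) ^+ 2
    <= 2 * N%:R ^+ 2 * #|Omega|%:R.
Proof.
move=> f1 f0; set M := #|Omega|%:R : R; have M0 : 0 <= M by [].
pose a : V := (1, 0); pose b : V := (0, 1).
have [a0 b0 ab] : [/\ a != 0, b != 0 & a != b].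
  by split; rewrite xpair_eqE ?oner_eq0 ?andbF.
have [T TE] : exists T, T = corr f a b by exists (corr f a b).
have sq k : f k ^+ 2 <= 1 by rewrite -real_normK ?num_real// expr_le1.
have -> : \sum_(s in Omega) (\sum_(k : V | k != 0) f (pos s k) * f k) ^+ 2 =
    \sum_(k : V | k != 0) \sum_(l : V | l != 0) f k * f l * corr f k l.
  under [RHS]eq_bigr => k _.
    under eq_bigr do rewrite mulr_sumr.
    rewrite exchange_big; over.
  rewrite [RHS]exchange_big; apply: eq_bigr => s _ /=.
  rewrite expr2 mulr_suml; apply: eq_bigr => k _; rewrite mulr_sumr.
  by apply: eq_bigr => l _; ring.
(* All off-diagonal correlations equal T, and the sum of f off 0 is - f 0, so only the diagonal and
   one term in T remain instead of N^4 terms. *)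
have -> : \sum_(k : V | k != 0) \sum_(l : V | l != 0) f k * f l * corr f k l =
    \sum_(k : V | k != 0) f k ^+ 2 * (corr f k k - T) + f 0 ^+ 2 * T.
  have fE : f 0 = - \sum_(k : V | k != 0) f k.
    by move/eqP: f0; rewrite (bigD1 (0 : V))//= addr_eq0 => /eqP.
  rewrite fE sqrrN expr2. rewrite mulr_suml mulr_suml -big_split; apply: eq_bigr => k k0 /=.
  rewrite mulr_sumr mulr_suml (bigD1 k)//= [X in _ = _ + X](bigD1 k)//=.
  rewrite addrA; congr (_ + _); first by ring.
  apply: eq_bigr => l /andP[l0 lk]; congr (_ * _).
  by rewrite TE; apply: corr_const => //; rewrite eq_sym.
have cM k l : corr f k l <= M by apply: le_trans (ler_norm _) (corr_le _ _ f1).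
have cM' k l : - M <= corr f k l by have := corr_le k l f1; rewrite ler_norml => /andP[].
apply: le_trans (_ : \sum_(k : V | k != 0) 2 * M + 2 * M <= _).
  apply: lerD.
    apply: ler_sum => k _; have := sq k; have := sqr_ge0 (f k).
    by have := cM k k; have := cM' a b; rewrite -TE; nra.
  by have := sq 0; have := sqr_ge0 (f 0); have := cM a b; rewrite -TE; nra.
rewrite sum_off_const le_eqVlt; apply/orP; left; apply/eqP.
by move: (N%:R : R) => x; ring.
Qed.

(** Shifting by (1, 0) multiplies the complex sum by exp(i theta), which is not 1 because sin theta
    > 0 for N >= 3. *)
Lemma sum_phases : \sum_(u : V) cosz R u.1 = 0 /\ \sum_(u : V) sinz R u.1 = 0.
Proof.
set C := \sum_(u : V) cosz _ _; set S := \sum_(u : V) sinz _ _.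
set c := cos (theta R n); set d := sin (theta R n).
have sE : sinz R (1 : 'Z_n) = d by rewrite (sinz_nat R n 1) mul1r.
have d0 : 0 < d.
  apply: sin_gt0_pi; rewrite theta_gt0 /theta ltr_pdivrMr//.
  by have := torus_side_ge3 R n3; have := pi_gt0 R; rewrite [pi *+ 2]mulr2n; nra.
have H1 : C = c * C - d * S.
  rewrite {1}/C -(sum_shift _ ((1, 0) : V)) !mulr_sumr -sumrB.
  by apply: eq_bigr => -[x y] _; rewrite -[(_ + _).1]/(x + 1) coszD cosz1 sE -/c mulrC (mulrC d).
have H2 : S = c * S + d * C.
  rewrite {1}/S -(sum_shift _ ((1, 0) : V)) !mulr_sumr -big_split.
  by apply: eq_bigr => -[x y] _; rewrite -[(_ + _).1]/(x + 1) sinzD cosz1 sE -/c mulrC (mulrC d).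
have q0 : (1 - c) ^+ 2 + d ^+ 2 != 0.
  by rewrite gt_eqF// ltr_wpDl ?sqr_ge0// exprn_gt0.
split; apply: (mulfI q0); rewrite mulr0.
  transitivity ((1 - c) * (C - (c * C - d * S)) - d * (S - (c * S + d * C))); first by ring.
  by rewrite -H1 -H2; ring.
transitivity ((1 - c) * (S - (c * S + d * C)) + d * (C - (c * C - d * S))); first by ring.
by rewrite -H1 -H2; ring.
Qed.

Lemma stationary_moment :
  \sum_(y : loyd_state n) uniform_dist R y * observable (@unit1 R n) (val y) ^+ 2
    <= 8 * N%:R ^+ 2.
Proof.
have cardE : #|{: loyd_state n}| = #|Omega| by rewrite card_sig.
have M0 : 0 < #|Omega|%:R :> R.
  rewrite ltr0n; apply/card_gt0P; exists 1%g.
  by rewrite /state_space; case: ifP => _; rewrite !inE// odd_perm1 /hole invg1 perm1.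
rewrite /uniform_dist cardE -mulr_sumr mulrC ler_pdivrMr//.
rewrite -(big_sub Omega (fun s => observable (@unit1 R n) s ^+ 2)).
have [C0 S0] := sum_phases.
have := sum_overlap_sqr (fun u => cos_max ((u.1 : nat)%:R * theta R n)) C0.
have := sum_overlap_sqr (fun u => sin_max ((u.1 : nat)%:R * theta R n)) S0.
set A := \sum_(s in Omega) _ => hA; set B := \sum_(s in Omega) _ => hB.
(* The cosine of a displacement splits into a product of cosines plus a product of sines, and (a +
   b)^2 <= 2 a^2 + 2 b^2. *)
apply: le_trans (_ : 2 * B + 2 * A <= _); last by lra.
rewrite !mulr_sumr -big_split; apply: ler_sum => s _ /=.
rewrite /observable /unit1 /=.
set a := \sum_(k | _) _ * cos _; set b := \sum_(k | _) _ * sin _.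
have -> : \sum_(k : V | k != 0) (cosz R (pos s k - k).1 * 1 - sinz R (pos s k - k).1 * 0)
    = a + b.
  rewrite -big_split; apply: eq_bigr => k _ /=.
  by rewrite mulr1 mulr0 subr0 coszD coszN sinzN mulrN opprK.
have := sqr_ge0 (a - b); nra.
Qed.

End StationaryMoment.

(** * The lower bound *)

Section LowerBound.
Variables (R : realType) (n : nat).
Local Notation V := (torus n).
Local Notation N := (Zp_trunc n).+2.
Hypothesis n3 : (2 < n)%N.
Local Notation K := (@loyd_kernel n R).
Local Notation prof := (@profile R n).

Lemma id_state : (1%g : config n) \in state_space n.
Proof. by rewrite /state_space; case: ifP => _; rewrite !inE// odd_perm1 /hole invg1 perm1. Qed.

Lemma profile0 j : prof j 0 = (1, 0).
Proof.
elim: j => // j IH; rewrite -[LHS]/(evolve (prof j) 0) /evolve.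
have tw d : twist d (prof j) 0 = (1, 0).
  rewrite /twist /turn /hop eqxx /= IH /rot cosz0 sinz0 /=.
  by congr pair; ring.
rewrite IH !big_cons !big_nil !tw /=.
by congr pair; [field|ring].
Qed.

(** At the identity all displacements vanish and the relative positions of the hole run over all u
    other than 0; the isolated point accounts for the - 1. *)
Lemma observable_id j : observable (prof j) 1%g = mass R n j - 1.
Proof.
have h0 : hole (1%g : config n) = 0 by rewrite /hole invg1 perm1.
have -> : mass R n j = \sum_(k : V) (prof j (- k)).1.
  rewrite [RHS](reindex_inj (@oppr_inj V)); apply: eq_bigr => u _.
  by rewrite /dotp mul1r mul0r addr0 opprK.
rewrite [in RHS](bigD1 (0 : V))//= oppr0 profile0 addrAC subrr add0r.
apply: eq_bigr => k _; rewrite h0 /pos invg1 perm1 subrr sub0r.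
by rewrite cosz0 sinz0 mul1r mul0r subr0.
Qed.

Lemma one_sub_ge_exp (z : R) : 0 <= z <= 2^-1 -> expR (- (2 * z)) <= 1 - z.
Proof.
move=> /andP[z0 z1]; rewrite expRN -div1r ler_pdivrMr ?expR_gt0//.
apply: le_trans (_ : (1 - z) * (1 + 2 * z) <= _); first by nra.
by rewrite ler_wpM2l ?expR_ge1Dx//; lra.
Qed.

Lemma mass_ge_exp t : N%:R ^+ 2 * expR (- (32 / N%:R ^+ 4 * t%:R)) <= mass R n t.
Proof.
apply: le_trans (mass_ge R n3 t); rewrite ler_pM2l ?exprn_gt0//.
pose z : R := 16 / N%:R ^+ 4; have z2 : 0 <= z <= 2^-1.
  apply/andP; split; first by apply: divr_ge0 => //; exact: exprn_ge0.
  rewrite ler_pdivrMr ?exprn_gt0//.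
  have := torus_side_ge3 R n3; move: (N%:R : R) => x x3; have : 9 <= x ^+ 2 by nra.
  by rewrite (_ : x ^+ 4 = x ^+ 2 * x ^+ 2) -?exprD//; nra.
have -> : 32 / N%:R ^+ 4 = 2 * z by rewrite /z mulrA; congr (_ / _); ring.
rewrite -/z -mulNr expRM_natr lerXn2r ?nnegrE ?expR_ge0 ?one_sub_ge_exp//.
by case/andP: z2 => _; lra.
Qed.

(** Here y = N^(1/16). The mean is at least y^31 / 2, the variance at most t r^2 with t <= y^65 / 32
    and r of order y^-4, hence of order y^57, and the stationary moment at most 8 y^32. The error in
    [tv_dist_ge] is thus of order y^(57 - 62). *)
Lemma not_mixed (y eps : R) (t : nat) : 2 <= y -> y ^+ 16 = N%:R ->
  t%:R <= y ^+ 64 * ln y / 32 -> ((512 * 256) ^+ 2 / 2 + 128) / y < 1 - eps ->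
  ~~ mixed K (@uniform_dist R (loyd_state n)) eps t.
Proof.
move=> y2 yN ty ey; apply/negP => /forallP /(_ (Sub 1%g id_state)); apply/negP.
rewrite -ltNge; have y0 : 0 < y by lra.
set x0 : loyd_state n := Sub _ _.
pose F j (x : loyd_state n) := observable (prof j) (val x).
set B := 512 * 256 in ey.
have x1 : 1 <= y ^+ 4 by rewrite exprn_ege1//; lra.
have xN : (y ^+ 4) ^+ 4 = N%:R by rewrite -exprM.
have B0 : 0 <= B by rewrite mulr_ge0.
have r0 : 0 <= B / y ^+ 4 by rewrite divr_ge0// exprn_ge0// ltW.
have var := avg_at_variance (F := F) (@loyd_kernel_ge0 R n) (loyd_kernel_sum R n3)
  (loyd_observable R n3) (r := (B / y ^+ 4) ^+ 2)
  (fun j x => observable_variation n3 x r0 (profile_gradient n3 x1 xN j)) t x0.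
have stat := stationary_moment R n3.
have Fx0 : F t x0 = mass R n t - 1 by rewrite -observable_id.
have m1 : y ^+ 31 / 2 <= F t x0.
  have y31 : 2 <= y ^+ 31 by rewrite exprS; have := @exprn_ege1 R 30 y; nra.
  have : y ^+ 31 <= mass R n t; last by rewrite Fx0; lra.
  apply: le_trans (mass_ge_exp t).
  have -> : y ^+ 31 = N%:R ^+ 2 * expR (- ln y).
    by rewrite expRN lnK ?posrE// -yN -exprM [y ^+ 32]exprSr mulfK// gt_eqF.
  rewrite ler_pM2l ?exprn_gt0// ler_expR lerN2 -yN -exprM.
  apply: le_trans (ler_wpM2l _ ty) _; first by rewrite divr_ge0// exprn_ge0// ltW.
  by rewrite le_eqVlt; apply/orP; left; apply/eqP; field; rewrite gt_eqF.
have y31 : 0 < y ^+ 31 / 2 by rewrite divr_gt0 ?exprn_gt0.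
have m0 : 0 < F t x0 := lt_le_trans y31 m1.
have := @tv_dist_ge R (loyd_state n) (kernel_pow K t x0) (@uniform_dist R _) (F 0) _ m0
  (kernel_pow_ge0 (@loyd_kernel_ge0 R n) t x0) _
  (sum_kernel_pow (loyd_kernel_sum R n3) t x0).
have u0 x : 0 <= @uniform_dist R (loyd_state n) x by rewrite /uniform_dist invr_ge0.
have u1 : \sum_x @uniform_dist R (loyd_state n) x = 1.
  rewrite /uniform_dist sumr_const -[_ *+ _]mulr_natl mulfV// pnatr_eq0 -lt0n.
  by apply/card_gt0P; exists x0.
move=> /(_ u0 u1); apply: lt_le_trans.
rewrite ltrBrDl -ltrBrDr; apply: le_lt_trans ey.
move: (F t x0) m1 m0 var stat => m m1 m0 var stat.
set s1 := \sum_x kernel_pow _ _ _ _ * _; set s2 := \sum_x uniform_dist _ _ * _.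
have lny : ln y <= y by rewrite ltW// ln_sublinear.
have s1P : s1 <= B ^+ 2 / 32 * y ^+ 57.
  apply: le_trans var _.
  have ty' : t%:R <= y ^+ 65 / 32.
    by apply: le_trans ty _; rewrite ler_pM2r ?invr_gt0// [y ^+ 65]exprSr ler_pM2l ?exprn_gt0.
  apply: le_trans (ler_wpM2r (sqr_ge0 _) ty') _.
  by rewrite le_eqVlt; apply/orP; left; apply/eqP; field; rewrite gt_eqF.
have s2P : s2 <= 8 * y ^+ 57.
  apply: le_trans stat _; rewrite ler_pM2l// -yN -exprM.
  by rewrite ler_weXn2l//; lra.
have s0 : 0 <= s1 + s2.
  apply: addr_ge0; apply: sumr_ge0 => x _; apply: mulr_ge0; rewrite ?sqr_ge0//.
  exact: kernel_pow_ge0 (@loyd_kernel_ge0 R n) t x0 x.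
have m2 : 4 / m ^+ 2 <= 16 / y ^+ 62.
  have -> : 16 / y ^+ 62 = 4 / (y ^+ 31 / 2) ^+ 2 by field; rewrite gt_eqF.
  rewrite ler_pM2l// lef_pV2 ?posrE ?exprn_gt0//.
  by rewrite lerXn2r ?nnegrE// ltW.
apply: le_trans (_ : 16 / y ^+ 62 * ((B ^+ 2 / 32 + 8) * y ^+ 57) <= _).
  apply: ler_pM => //; first by rewrite divr_ge0 ?sqr_ge0.
  by rewrite mulrDl lerD.
have -> : 16 / y ^+ 62 * ((B ^+ 2 / 32 + 8) * y ^+ 57) =
    (B ^+ 2 / 2 + 128) / y ^+ 5 by field; rewrite gt_eqF.
rewrite ler_wpM2l ?addr_ge0 ?divr_ge0 ?sqr_ge0// lef_pV2 ?posrE ?exprn_gt0//.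
by rewrite -[leLHS]expr1 ler_weXn2l//; lra.
Qed.

End LowerBound.

Theorem theorem11 (R : realType) :
  exists2 c : R, 0 < c &
    forall eps : R, 0 < eps < 1 ->
    exists N : nat, forall n : nat, (2 <= n)%N -> (N <= n)%N ->
      ((c * n%:R ^+ 4 * ln n%:R)%:E <
        mixing_time (@loyd_kernel n R) (@uniform_dist R (loyd_state n)) eps)%E.
Proof.
(* With n = y^16 one has n^4 ln n = 16 y^64 ln y, and 16/512 = 1/32 is the constant in
   [not_mixed]. *)
exists 512^-1; first by rewrite invr_gt0.
move=> eps /andP[eps0 eps1]; have e0 : 0 < 1 - eps by rewrite subr_gt0.
pose D : R := (512 * 256) ^+ 2 / 2 + 128.
have D0 : 0 <= D by rewrite addr_ge0// divr_ge0// sqr_ge0.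
(* A < y yields both 2 <= y and D / y < 1 - eps; the threshold for n exceeds A^16, and the added 3
   ensures n > 2. *)
pose A : R := D / (1 - eps) + 2.
have A2 : 2 <= A by rewrite lerDr divr_ge0// ltW.
exists (Num.truncn (A ^+ 16)).+3 => n _ nN.
have n3 : (2 < n)%N by apply: leq_trans nN.
have n0 : 0 < n%:R :> R by rewrite ltr0n (ltn_trans _ n3).
pose y : R := expR (ln n%:R / 16).
have y0 : 0 < y by rewrite expR_gt0.
have yn : y ^+ 16 = n%:R by rewrite /y -expRM_natr divfK ?pnatr_eq0// lnK ?posrE.
have Ay : A < y.
  rewrite ltNge; apply/negP => yA; have : y ^+ 16 <= A ^+ 16.
    by rewrite lerXn2r ?nnegrE ?(ltW y0)//; lra.
  rewrite yn leNgt => /negP; apply.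
  have /andP[_] : (Num.truncn (A ^+ 16))%:R <= A ^+ 16 < (Num.truncn (A ^+ 16)).+1%:R.
    by rewrite truncn_itv// exprn_ge0//; lra.
  move=> /lt_le_trans; apply; rewrite ler_nat; apply: leq_trans nN.
  by rewrite ltnS (leq_trans (leqnSn _)).
have lnn : ln n%:R = 16 * ln y by rewrite -yn lnXn// -[LHS]mulr_natl.
rewrite /mixing_time; case: pselect => [ex|_]; last exact: ltry.
(* The least mixed time is itself mixed, so it is enough to contradict [not_mixed] at that time. *)
rewrite lte_fin ltNge; case: ex_minnP => t tmix _; apply/negP => tle.
suff : ~~ mixed (@loyd_kernel n R) (@uniform_dist R (loyd_state n)) eps t.
  by rewrite tmix.
apply: (not_mixed n3 (y := y)).
- by lra.
- by rewrite torus_side.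
- apply: le_trans tle _; rewrite lnn -yn -exprM.
  by rewrite le_eqVlt; apply/orP; left; apply/eqP; field.
- rewrite ltr_pdivrMr// -ltr_pdivrMl// mulrC -/D; apply: lt_trans Ay.
  by rewrite ltrDl.
Qed.
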